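(* For every integer $k\ge 4$ and every real $\varepsilon$ with $0<\varepsilon\le 1$ there exist constants $c>0$ and $n_0$, depending only on $k$ and $\varepsilon$, such that the following holds for every integer $n\ge n_0$ and every real $t$ with $(\log n)^{12k/\varepsilon}\le t\le n^{1/(1+\varepsilon)}$. Let $H$ be a $k$-graph on $n$ vertices with $$\Delta_1(H)\le t^{k-1},\qquad \Delta_i(H)\le t^{k-i-\varepsilon}\ \text{ for } 2\le i\le k-2,\qquad \Delta_{k-1}(H)\le \frac{t}{(\log t)^{k+1}} .$$ If $H$ contains no $4$-cycle with clean intersections, then $$\alpha(H)\ \ge\ c\,\frac nt(\log t)^{1/(k-1)} .$$
   Context: A $k$-graph ($k$-uniform hypergraph) $H$ consists of a finite vertex set $V(H)$ and an edge set, which is a family of $k$-element subsets of $V(H)$. An independent set is a set of vertices containing no edge, and $\alpha(H)$ is the size of a largest independent set. For $S\subseteq V(H)$, $\deg_H(S)$ is the number of edges containing $S$; $\Delta_i(H)$ is the maximum of $\deg_H(S)$ over all $i$-subsets $S$ of $V(H)$. All logarithms are natural. A $4$-cycle consists of four distinct edges $e_1,e_2,e_3,e_4$ for which there exist distinct vertices $v_1,\dots,v_4$ with $v_i\in e_i\cap e_{i+1}$ for $i=1,\dots,4$ (where $e_5=e_1$). It has clean intersections if $e_1\cap e_3=\emptyset$ and $e_2\cap e_4=\emptyset$. *)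

(* Defs.v *)
From HB Require Import structures.
From mathcomp Require Import all_boot all_order all_algebra.
From mathcomp Require Import reals exp.

Set Implicit Arguments.
Unset Strict Implicit.
Unset Printing Implicit Defensive.

(* A hypergraph is given by its edge set H : {set {set V}}; the finite type V
   is its whole vertex set, so isolated vertices are allowed. *)

Definition uniform (V : finType) (k : nat) (H : {set {set V}}) : Prop :=
  forall e : {set V}, e \in H -> #|e| = k.

Definition independent (V : finType) (H : {set {set V}}) (I : {set V}) : bool :=
  [forall e in H, ~~ (e \subset I)].

Definition alpha (V : finType) (H : {set {set V}}) : nat :=
  \max_(I : {set V} | independent H I) #|I|.

Definition deg (V : finType) (H : {set {set V}}) (S : {set V}) : nat :=
  #|[set e in H | S \subset e]|.

Definition max_deg (V : finType) (i : nat) (H : {set {set V}}) : nat :=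
  \max_(S : {set V} | #|S| == i) deg H S.

Definition four_cycle (V : finType) (H : {set {set V}})
    (e1 e2 e3 e4 : {set V}) : Prop :=
  [/\ [/\ e1 \in H, e2 \in H, e3 \in H & e4 \in H],
      uniq [:: e1; e2; e3; e4]
    & exists v1 v2 v3 v4 : V,
        uniq [:: v1; v2; v3; v4] /\
        [/\ v1 \in e1 :&: e2, v2 \in e2 :&: e3,
            v3 \in e3 :&: e4 & v4 \in e4 :&: e1]].

Definition clean_intersections (V : finType) (e1 e2 e3 e4 : {set V}) : Prop :=
  e1 :&: e3 = set0 /\ e2 :&: e4 = set0.

Definition has_clean_four_cycle (V : finType) (H : {set {set V}}) : Prop :=
  exists e1 e2 e3 e4 : {set V},
    four_cycle H e1 e2 e3 e4 /\ clean_intersections e1 e2 e3 e4.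

(* Main.v *)
Require Import Defs.
From HB Require Import structures.
From mathcomp Require Import all_boot all_order all_algebra.
From mathcomp Require Import reals sequences exp.
From mathcomp Require Import ring lra zify.

Set Implicit Arguments.
Unset Strict Implicit.
Unset Printing Implicit Defensive.

Import Order.TTheory GRing.Theory Num.Theory.
Local Open Scope ring_scope.

(** The proof has two halves.

    Sampling.  Put s = t^(eps/8k) and T = s^2, and keep each vertex with
    probability T/t.  Every configuration in which an edge has to contain a
    given set of 2 up to k-2 vertices loses a factor t^(-eps) = s^(-8k) in its
    count, while the sampling density only brings back a factor T^(3k) = s^(6k).
    Hence the expected number of pairs of edges meeting in 2 up to k-2 vertices,
    and of triples a, b, c with a meeting b and c having exactly two vertices in
    their union, is a small fraction of the number of sampled vertices, and one
    vertex of each can be deleted (lemma clean_sample).  In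
    what remains the degrees are O(T^(k-1)) and any two vertices x, y of an edge
    e are joined, by edges avoiding the other one, to at most one common vertex
    outside e (lemma shared_le1).

    Weighted greedy choice.  Choose vertices one at a time.  Every vertex u
    carries a weight w u, initially 1, and the next vertex is v with probability
    w v / Z, where Z is the total weight.  A vertex is dead, of weight 0, as soon
    as it is chosen or completes an edge with chosen vertices; so the chosen
    set is always independent and the process succeeds as long as Z stays
    positive.  Each survivor is divided by its probability of surviving the
    step, which makes every weight a martingale, and Z is constant on average.
    Weights that exceed a cap M are set to 0; what this costs is controlled by
    the entropy, the sum of w ln w, since a weight above M accounts for at least
    ln M times as much entropy.  The entropy grows by the sum of w u * load u, which counts
    edges with exactly two vertices left.  To bound these, follow for every
    edge e the product over x in e of (w x + lam * [x chosen]) with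
    lam = N / m, where N is the number of vertices and m the number of steps.
    Were the deaths of two vertices of e independent, this product would only
    grow by a factor 1 + O(1/m) in each step; the correlation comes from
    vertices that would kill two vertices of e at once, and by shared_le1 there
    are at most k + 1 of those.  So the products stay within a constant of their
    initial value, m steps create entropy O(N (mT/N)^(k-1)), and this is
    negligible against N ln M as long as (mT/N)^(k-1) is a small multiple of
    ln t.  This yields m of order (N/T) (ln t)^(1/(k-1)), which is of order
    (n/t) (ln t)^(1/(k-1)) because N is of order n T / t.

    No probability space is needed in the second half: total weight, entropy
    and products are combined into one potential whose average over the next
    vertex does not drop by more than a constant, so that some choice of the
    next vertex keeps it large (lemma potential_step). *)

(** * The weighted greedy process *)

Section WeightedGreedy.
Variables (R : realType) (V : finType) (H : {set {set V}}).
Implicit Types (I e : {set V}) (w : V -> R) (u v x y : V).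

Definition total w : R := \sum_v w v.

(** Choosing v kills u: either v is u, or u becomes the only missing vertex of
    an edge.  The relation is symmetric in u and v. *)
Definition conflict I u v : bool :=
  (v == u) || [exists e in H, [&& u \in e, v \in e & e :\ u :\ v \subset I]].

(** The probability that the next choice kills u. *)
Definition load I w u : R := (\sum_(v | conflict I u v) w v) / total w.

(** The division by the survival probability makes each weight a martingale. *)
Definition boost I w v u : R :=
  if conflict I u v then 0 else w u / (1 - load I w u).

(** Without a cap a single weight could carry a constant part of the total,
    and a single choice would then matter too much. *)
Definition capped M w u : R := if M < w u then 0 else w u.

(** The vertices outside e through which x and y can die simultaneously: only
    an edge f that avoids y can become a threat for x while y is not chosen. *)
Definition shared e x y : {set V} :=
  [set v | [&& v \notin e,
    [exists f in H, [&& x \in f, v \in f & y \notin f]] &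
    [exists f in H, [&& y \in f, v \in f & x \notin f]]]].

(** A chosen vertex has weight 0, so each factor is either the weight of a free
    vertex or lam.  Giving chosen vertices the value lam makes all stages of the
    life of an edge visible in a single product. *)
Definition edge_weight (lam : R) I w e : R :=
  \prod_(x in e) (w x + lam * (x \in I)%:R).

Definition pressure (lam : R) I w : R := \sum_(e in H) edge_weight lam I w e.

Definition entropy w : R := \sum_u w u * ln (w u).

(** Weights vanish or are at least 1, because survivors only grow; this is what
    makes every term of the entropy nonnegative. *)
Record valid (M : R) (U : {set V}) I w : Prop := Valid {
  valid_range : forall u, w u = 0 \/ 1 <= w u <= M;
  valid_chosen : forall u, u \in I -> w u = 0;
  valid_blocked : forall e x,
    e \in H -> x \in e -> e :\ x \subset I -> w x = 0;
  valid_support : forall u, u \notin U -> w u = 0;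
  valid_sub : I \subset U;
  valid_indep : independent H I }.

Lemma conflictxx I u : conflict I u u.
Proof. by rewrite /conflict eqxx. Qed.

Lemma weierstrass (s : seq V) (P : pred V) (b : V -> R) :
  (forall x, P x -> 0 <= b x <= 1) ->
  1 - \sum_(x <- s | P x) b x <= \prod_(x <- s | P x) (1 - b x).
Proof.
move=> hb; have hp r : 0 <= \prod_(x <- r | P x) (1 - b x) <= 1.
  elim: r => [|a r IH]; first by rewrite big_nil ler01 lexx.
  rewrite big_cons; case: ifP => // /hb; move: IH.
  set q := \prod_(_ <- _ | _) _ => *; apply/andP; split; nra.
elim: s => [|a s IH]; first by rewrite !big_nil subr0.
rewrite !big_cons; case: ifP => // /hb; move: IH (hp s).
set q := \prod_(_ <- _ | _) _; set t := \sum_(_ <- _ | _) _ => *; nra.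
Qed.

Section Step.
Variables (M : R) (U I : {set V}) (w : V -> R).
Hypothesis M_ge1 : 1 <= M.
Hypothesis w_valid : valid M U I w.
Hypothesis Z_gt0 : 0 < total w.
Hypothesis load_le : forall u, load I w u <= 2^-1.

Let w_ge0 u : 0 <= w u.
Proof. by case: (valid_range w_valid u) => [->//|/andP[+ _]]; lra. Qed.

Lemma weight_le u : w u <= M.
Proof.
by have [->|/andP[_ //]] := valid_range w_valid u; exact: le_trans M_ge1.
Qed.

Lemma load_ge0 u : 0 <= load I w u.
Proof. by rewrite divr_ge0 ?sumr_ge0 // ltW. Qed.

Let b_ge0 := load_ge0.

Lemma boost_ge0 v u : 0 <= boost I w v u.
Proof.
rewrite /boost; case: ifP => // _; apply: divr_ge0 => //.
by have := load_le u; lra.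
Qed.

Lemma boost_le v u : boost I w v u <= w u / (1 - load I w u).
Proof.
rewrite /boost; case: ifP => // _; apply: divr_ge0 => //.
by have := load_le u; lra.
Qed.

Lemma sum_prob : \sum_v w v / total w = 1.
Proof. by rewrite -mulr_suml divff // gt_eqF. Qed.

Lemma sum_prob_conflict u :
  \sum_(v | conflict I u v) w v / total w = load I w u.
Proof. by rewrite -mulr_suml. Qed.

(** Whatever function of the new weight is averaged, only the survivors
    contribute, and u survives with probability 1 - load u. *)
Lemma average_boost (g : R -> R) : g 0 = 0 ->
  \sum_v w v / total w * (\sum_u g (boost I w v u)) =
  \sum_u (1 - load I w u) * g (w u / (1 - load I w u)).
Proof.
move=> g0; under eq_bigr do rewrite mulr_sumr.
rewrite exchange_big; apply: eq_bigr => u _ /=.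
have E : 1 - load I w u = \sum_(v | ~~ conflict I u v) w v / total w.
  have := sum_prob; rewrite (bigID (conflict I u)) /= sum_prob_conflict => <-.
  by rewrite addrAC subrr add0r.
rewrite [X in _ = X * _]E (bigID (conflict I u)) /= big1 ?add0r => [|v uv]; last first.
  by rewrite /boost uv g0 mulr0.
rewrite mulr_suml; apply: eq_bigr => v /negbTE uv.
by rewrite /boost uv.
Qed.

Lemma average_total : \sum_v w v / total w * total (boost I w v) = total w.
Proof.
rewrite (average_boost (g := id)) //; apply: eq_bigr => u _.
by rewrite mulrC divfK // gt_eqF //; have := load_le u; lra.
Qed.

(** On survival ln (w u) increases by - ln (1 - load u), which is at most
    2 load u because the loads are at most 1/2. *)
Lemma average_entropy :
  \sum_v w v / total w * entropy (boost I w v) <=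
  entropy w + 2 * \sum_u w u * load I w u.
Proof.
rewrite (average_boost (g := fun z => z * ln z)) ?mul0r // mulr_sumr -big_split.
apply: ler_sum => u _ /=; have bu := load_le u; have b0 := b_ge0 u.
set b := load I w u in bu b0 *.
have -> : (1 - b) * (w u / (1 - b) * ln (w u / (1 - b))) =
    w u * ln (w u / (1 - b)) by field; lra.
have [->|w_gt0] := valid_range w_valid u; first by rewrite !mul0r mulr0 addr0.
have wu0 : 0 < w u by lra.
rewrite ln_div ?posrE //; last by lra.
have : - ln (1 - b) <= 2 * b.
  rewrite -lnV ?posrE; last by lra.
  have -> : (1 - b)^-1 = 1 + b / (1 - b) by field; lra.
  apply: le_trans (le_ln1Dx _) _.
    by rewrite (lt_le_trans (ltrN10 _)) // divr_ge0 //; lra.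
  by rewrite ler_pdivrMr; nra.
by move=> ?; nra.
Qed.

(** Apart from u itself, the load of u comes from edges e whose free vertices
    are exactly u and some v.  Such an edge has k - 2 chosen vertices, so that its
    edge weight is at least lam^(k-2) * w u * w v; each edge occurs for at most k^2
    pairs (u, v). *)
Lemma sum_load_le (k : nat) (lam : R) : uniform k H -> (2 <= k)%N -> 0 < lam ->
  \sum_u w u * load I w u <=
  M + (k ^ 2)%:R * pressure lam I w / (lam ^+ (k - 2) * total w).
Proof.
move=> Hk k2 lam0.
pose c u v e := [&& u \in e, v \in e, v != u & e :\ u :\ v \subset I].
have lk0 : 0 < lam ^+ (k - 2) by rewrite exprn_gt0.
have g_ge0 x : 0 <= w x + lam * (x \in I)%:R 
  by apply: addr_ge0 => //; apply: mulr_ge0 => //; exact: ltW.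
have Ple e u v : e \in H -> c u v e -> w u * w v <=
    edge_weight lam I w e / lam ^+ (k - 2).
  move=> He /and4P[ue ve vu esub]; rewrite ler_pdivlMr //.
  rewrite /edge_weight (big_setD1 u) //= (big_setD1 v) ?in_setD1 ?vu //=.
  rewrite mulrA; apply: ler_pM => //; try exact: mulr_ge0; try exact: ltW.
    by apply: ler_pM; rewrite // lerDl; apply: mulr_ge0; rewrite // ltW.
  have -> : (k - 2)%N = #|e :\ u :\ v|.
    have := cardsD1 u e; have := cardsD1 v (e :\ u).
    by rewrite in_setD1 vu ue ve (Hk _ He); lia.
  rewrite -prodr_const; apply: ler_prod => x xe.
  by rewrite (subsetP esub x xe) mulr1 lerDr w_ge0 ltW.
have step u : w u * load I w u <= w u * M / total w +
    (\sum_(e in H) \sum_(v | c u v e) w u * w v) / total w.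
  rewrite /load mulrA -mulrDl ler_pM2r ?invr_gt0 //.
  rewrite (bigD1 u) ?conflictxx //= mulrDr; apply: lerD.
    by apply: ler_wpM2l => //; exact: weight_le.
  rewrite (exchange_big_dep (fun v => [exists e in H, c u v e])) /=; last first.
    by move=> e v He cv; apply/existsP; exists e; rewrite He.
  rewrite mulr_sumr.
  have eqc v : conflict I u v && (v != u) = [exists e in H, c u v e].
    rewrite /conflict /c; apply/andP/idP => [[/orP[/eqP->|] ]|].
    - by rewrite eqxx.
    - move=> /existsP[e /and4P[He ue ve se]] vu.
      by apply/existsP; exists e; rewrite He ue ve vu se.
    - move=> /existsP[e /andP[He /and4P[ue ve vu se]]]; rewrite vu; split=> //.
      by apply/orP; right; apply/existsP; exists e; rewrite He ue ve se.
  rewrite (eq_bigl _ _ eqc); apply: ler_sum => v /existsP[e /andP[He ce]].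
  rewrite (bigD1 e) ?He //= lerDl sumr_ge0 // => *; exact: mulr_ge0.
apply: le_trans (ler_sum _ (fun u _ => step u)) _; rewrite big_split /=.
apply: lerD.
  by rewrite -!mulr_suml -/(total w) mulrAC divff ?mul1r // gt_eqF.
rewrite -mulr_suml invfM [X in _ <= X]mulrA ler_pM2r ?invr_gt0 //.
rewrite exchange_big /pressure mulr_sumr mulr_suml; apply: ler_sum => e He /=.
have -> : (k ^ 2)%:R * edge_weight lam I w e / lam ^+ (k - 2) =
    \sum_(u in e) \sum_(v in e) edge_weight lam I w e / lam ^+ (k - 2).
  rewrite !sumr_const (Hk _ He) -mulrnA mulnn -[RHS]mulr_natl; ring.
have q0 : 0 <= edge_weight lam I w e / lam ^+ (k - 2).
  by rewrite divr_ge0 ?(ltW lk0) // prodr_ge0.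
rewrite [X in X <= _](bigID (mem e)) /= [X in _ + X]big1 ?addr0; last first.
  by move=> u /negbTE ue; rewrite big_pred0 // => v; rewrite /c ue.
apply: ler_sum => u ue; rewrite big_mkcond [leRHS]big_mkcond /=.
apply: ler_sum => v _; case: ifP => [ce|_]; last by case: ifP.
have /and4P[_ -> _ _] := ce; exact: Ple.
Qed.

(** If v outside e threatens both x and y, then the two edges responsible
    consist of chosen vertices, v, and x or y respectively, so that v is shared.
    Hence the common threats are vertices of e, or the unique shared vertex. *)
Lemma conflict_common_le (k : nat) e x y : uniform k H -> e \in H ->
    (#|shared e x y| <= 1)%N ->
    x \in e -> y \in e -> x != y -> x \notin I -> y \notin I ->
  \sum_(v | conflict I x v && conflict I y v) w v <= k.+1%:R * M.
Proof.
move=> Hk He sh1 xe ye xy xI yI.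
have one z z' v : z' \in e -> z' \notin I -> conflict I z v -> v \notin e ->
    z \in e -> z != z' -> [exists f in H, [&& z \in f, v \in f & z' \notin f]].
  move=> z'e z'I /orP[/eqP->|]; first by move=> /negbTE->.
  move=> /existsP[f /and4P[Hf zf vf fsub]] ve _ zz'.
  apply/existsP; exists f; rewrite Hf zf vf /=.
  apply: contra z'I => z'f; apply: (subsetP fsub); rewrite !in_setD1 z'f andbT.
  by rewrite [z' == z]eq_sym zz' andbT; apply: contraNneq ve => <-.
have sub v : conflict I x v && conflict I y v -> v \in e :|: shared e x y.
  move=> /andP[xv yv]; rewrite in_setU inE; case: (boolP (v \in e)) => //= ve.
  by rewrite (one x y) //= (one y x) // eq_sym.
apply: le_trans (_ : \sum_(v in e :|: shared e x y) M <= _).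
  rewrite big_mkcond [leRHS]big_mkcond; apply: ler_sum => v _ /=.
  case: ifP => [/sub ->|_]; first exact: weight_le.
  by case: ifP => // _; exact: le_trans M_ge1.
rewrite sumr_const -[leLHS]mulr_natl ler_wpM2r ?(le_trans ler01) // ler_nat.
by rewrite (leq_trans (leq_card_setU _ _).1) // (Hk _ He) -addn1 leq_add2l.
Qed.

Lemma prod_inv_load_le (k : nat) e : uniform k H -> e \in H ->
  1 <= \prod_(x in e :\: I) (1 - load I w x)^-1 <= 2 ^+ k.
Proof.
move=> Hk He.
have h x : 1 <= (1 - load I w x)^-1 <= 2.
  have := load_le x; have := b_ge0 x; set b := load I w x => b0 b2.
  have b1 : 0 < 1 - b by lra.
  by rewrite -div1r ler_pdivlMr // ler_pdivrMr //; apply/andP; split; lra.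
apply/andP; split.
  apply: (big_ind (fun z => 1 <= z)) => // [y z|x _]; first exact: mulr_ege1.
  by have /andP[] := h x.
apply: le_trans (_ : 2 ^+ #|e :\: I| <= _).
  rewrite -prodr_const; apply: ler_prod => x _; have /andP[? ->] := h x.
  by rewrite (le_trans ler01).
by rewrite ler_weXn2l ?ler1n // -(Hk _ He) subset_leq_card // subsetDl.
Qed.

(** Almost independence: the probability that no free vertex of e dies is at
    most the product of the individual survival probabilities, up to the
    probability of a common threat.  If a is the number of free vertices of e that
    v kills, then [a = 0] <= (1 - a)^2; the average of the square is
    1 - sum of loads + sum over x <> y of the common threats, and Weierstrass'
    inequality bounds 1 - sum of loads. *)
Lemma prob_avoid_le (k : nat) e : uniform k H -> e \in H ->
    (forall x y, x \in e -> y \in e -> x != y -> (#|shared e x y| <= 1)%N) ->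
  \sum_(v | [forall x in e :\: I, ~~ conflict I x v]) w v / total w <=
  \prod_(x in e :\: I) (1 - load I w x) +
    (k ^ 2)%:R * (k.+1%:R * M / total w).
Proof.
move=> Hk He sh1; pose B := e :\: I.
pose a x v : R := (conflict I x v)%:R.
have eta x y : \sum_v w v / total w * (a x v * a y v) =
    \sum_(v | conflict I x v && conflict I y v) w v / total w.
  rewrite [RHS]big_mkcond; apply: eq_bigr => v _; rewrite /a -natrM mulnb.
  by case: ifP; rewrite ?mulr1 ?mulr0.
have et x : \sum_v w v / total w * a x v = load I w x.
  rewrite -sum_prob_conflict [RHS]big_mkcond; apply: eq_bigr => v _.
  by rewrite /a; case: ifP; rewrite ?mulr1 ?mulr0.
apply: le_trans (_ : \sum_v w v / total w * (1 - \sum_(x in B) a x v) ^+ 2 <= _).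
  rewrite big_mkcond; apply: ler_sum => v _; case: ifP => [/forallP av|_]; last first.
    by rewrite mulr_ge0 ?sqr_ge0 // divr_ge0 // ltW.
  rewrite big1 ?subr0 ?expr1n ?mulr1 // => x xB.
  by have := av x; rewrite xB /a => /negbTE->.
have -> : \sum_v w v / total w * (1 - \sum_(x in B) a x v) ^+ 2 =
    1 - 2 * (\sum_(x in B) load I w x) +
    \sum_(x in B) \sum_(y in B) \sum_v w v / total w * (a x v * a y v).
  have -> : \sum_(x in B) \sum_(y in B) \sum_v w v / total w * (a x v * a y v) =
      \sum_v w v / total w * (\sum_(x in B) a x v) ^+ 2.
    under eq_bigr do rewrite exchange_big; rewrite exchange_big.
    apply: eq_bigr => v _ /=; rewrite expr2 mulr_suml mulr_sumr.
    by apply: eq_bigr => x _; rewrite !mulr_sumr.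
  have -> : \sum_(x in B) load I w x = \sum_v w v / total w * \sum_(x in B) a x v.
    under eq_bigr do rewrite -et; rewrite exchange_big.
    by apply: eq_bigr => v _; rewrite mulr_sumr.
  rewrite -{2}sum_prob mulr_sumr -sumrB -big_split; apply: eq_bigr => v _ /=.
  by ring.
have hd x : x \in B -> \sum_(y in B) \sum_v w v / total w * (a x v * a y v) <=
    load I w x + k%:R * (k.+1%:R * M / total w).
  move=> xB; rewrite (bigD1 x) //=; apply: lerD.
    rewrite -et; apply: ler_sum => v _; rewrite /a.
    by case: (conflict I x v); rewrite ?mulr0 ?mulr1.
  have c0 : 0 <= k.+1%:R * M / total w.
    by rewrite !mulr_ge0 ?invr_ge0 ?ltW // (lt_le_trans ltr01).
  apply: le_trans (_ : \sum_(y in B | y != x) k.+1%:R * M / total w <= _).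
    apply: ler_sum => y /andP[yB yx]; rewrite eta -mulr_suml.
    rewrite ler_pM2r ?invr_gt0 //.
    move: xB yB; rewrite !in_setD => /andP[xI xe] /andP[yI ye].
    apply: (conflict_common_le Hk He) => //; rewrite 1?eq_sym //.
    by apply: sh1; rewrite // eq_sym.
  rewrite sumr_const -[leLHS]mulr_natl ler_wpM2r // ler_nat -(Hk _ He).
  apply: leq_trans (subset_leq_card (subsetDl e I)); apply: subset_leq_card.
  by apply/subsetP => y /andP[].
have := weierstrass (index_enum V) (P := mem B) (b := load I w).
have bb x : mem B x -> 0 <= load I w x <= 1.
  by move=> _; rewrite b_ge0 (le_trans (load_le x)) //; lra.
move=> /(_ bb); rewrite -/B => hW.
have hC : #|B|%:R * (k%:R * (k.+1%:R * M / total w)) <=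
   (k ^ 2)%:R * (k.+1%:R * M / total w).
  rewrite mulrA -natrM ler_wpM2r //.
    by rewrite !mulr_ge0 ?invr_ge0 ?ltW // (lt_le_trans ltr01).
  by rewrite ler_nat -mulnn leq_mul2r -(Hk _ He) subset_leq_card ?orbT // subsetDl.
have hS : \sum_(x in B) \sum_(y in B) \sum_v w v / total w * (a x v * a y v) <=
    \sum_(x in B) load I w x + #|B|%:R * (k%:R * (k.+1%:R * M / total w)).
  by rewrite mulr_natl -sumr_const -big_split; apply: ler_sum.
by lra.
Qed.

(** A choice inside e turns one factor w v into lam, which costs lam / Z for
    each vertex of e.  A choice outside e keeps the product only if it kills no free
    vertex of e, and then the factors 1 / (1 - load) cancel the survival
    probabilities found in prob_avoid_le; the factor 2^k bounds the product of
    those corrections in the error terms. *)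
Lemma average_edge_weight (k : nat) (lam : R) e :
    uniform k H -> e \in H -> 0 < lam ->
    (forall x y, x \in e -> y \in e -> x != y -> (#|shared e x y| <= 1)%N) ->
  \sum_v w v / total w * edge_weight lam (v |: I) (boost I w v) e <=
  (1 + 2 ^+ k * ((k ^ 2)%:R * k.+1%:R * M / total w + k%:R * lam / total w)) *
  edge_weight lam I w e.
Proof.
move=> Hk He lam0 sh1; pose g x := w x + lam * (x \in I)%:R.
have g_ge0 x : 0 <= g x by apply: addr_ge0 => //; apply: mulr_ge0 => //; exact: ltW.
have gI x : x \in I -> g x = lam.
  by move=> xI; rewrite /g xI mulr1 (valid_chosen w_valid xI) add0r.
have gNI x : x \notin I -> g x = w x by move=> /negbTE xI; rewrite /g xI mulr0 addr0.
have wI v : w v != 0 -> v \notin I.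
  by apply: contra => vI; rewrite (valid_chosen w_valid vI).
have P0 : 0 <= edge_weight lam I w e.
  by apply: prodr_ge0 => x _; exact: g_ge0.
have Z0 := ltW Z_gt0; have M0 : 0 <= M := le_trans ler01 M_ge1.
have pi0 v : 0 <= w v / total w by rewrite divr_ge0.
pose r x := if x \in I then 1 else (1 - load I w x)^-1.
have r_ge1 x : 1 <= r x.
  rewrite /r; case: ifP => // _; have := load_le x; have := b_ge0 x => b0 b2.
  by rewrite -div1r ler_pdivlMr; lra.
have Er : \prod_(x in e) r x = \prod_(x in e :\: I) (1 - load I w x)^-1.
  rewrite (big_setID I) /= big1 ?mul1r => [|x /setIP[_ xI]]; last by rewrite /r xI.
  by apply: eq_bigr => x /setDP[_ /negbTE xI]; rewrite /r xI.
have /andP[r1 r2] := prod_inv_load_le Hk He; rewrite -Er in r1 r2.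
have g'_le v x : x != v -> boost I w v x + lam * (x \in v |: I)%:R <= g x * r x.
  move=> xv; rewrite in_setU1 (negbTE xv) /= /r; case: (boolP (x \in I)) => xI.
    by rewrite !mulr1 gI // (le_trans (lerD (boost_le _ _) (lexx _))) //
         (valid_chosen w_valid xI) mul0r add0r.
  by rewrite mulr0 addr0 gNI // boost_le.
have g'_ge0 v x : 0 <= boost I w v x + lam * (x \in v |: I)%:R.
  apply: addr_ge0; first exact: boost_ge0.
  by apply: mulr_ge0 => //; exact: ltW.
rewrite (bigID (mem e)) /=.
(* v in e: the factor w v becomes lam *)
have inside : \sum_(v in e) w v / total w *
    edge_weight lam (v |: I) (boost I w v) e <=
    2 ^+ k * (k%:R * lam / total w) * edge_weight lam I w e.
  apply: le_trans (_ : \sum_(v in e) 2 ^+ k * (lam / total w) *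
      edge_weight lam I w e <= _); last first.
    by rewrite sumr_const (Hk _ He) -[leLHS]mulr_natl; rewrite le_eqVlt;
       apply/orP; left; apply/eqP; ring.
  apply: ler_sum => v ve; have [->|wv0] := eqVneq (w v) 0.
    rewrite !mul0r; apply: mulr_ge0 => //; apply: mulr_ge0; first exact: exprn_ge0.
    by apply: divr_ge0 => //; exact: ltW.
  have vI := wI _ wv0.
  have -> : edge_weight lam (v |: I) (boost I w v) e = lam *
      \prod_(x in e :\ v) (boost I w v x + lam * (x \in v |: I)%:R).
    by rewrite /edge_weight (big_setD1 v) //= /boost conflictxx add0r setU11 mulr1.
  have h : \prod_(x in e :\ v) (boost I w v x + lam * (x \in v |: I)%:R) <=
      \prod_(x in e :\ v) g x * 2 ^+ k.
    apply: le_trans (_ : \prod_(x in e :\ v) (g x * r x) <= _).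
      by apply: ler_prod => x /setD1P[xv _]; rewrite g'_ge0 g'_le.
    rewrite big_split ler_wpM2l ?prodr_ge0 //; apply: le_trans r2.
    rewrite [leRHS](big_setD1 v) //= ler_peMl ?prodr_ge0 // => x _.
    exact: le_trans (r_ge1 x).
  have -> : edge_weight lam I w e = w v * \prod_(x in e :\ v) g x.
    by rewrite -gNI // /edge_weight (big_setD1 v).
  have -> : 2 ^+ k * (lam / total w) * (w v * \prod_(x in e :\ v) g x) =
    w v / total w * (lam * (\prod_(x in e :\ v) g x * 2 ^+ k)) by ring.
  by apply: ler_wpM2l => //; apply: ler_wpM2l => //; exact: ltW.
(* v not in e: either a free vertex of e dies, or every factor is boosted *)
have outside : \sum_(v | v \notin e) w v / total w *
    edge_weight lam (v |: I) (boost I w v) e <=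
    (1 + 2 ^+ k * ((k ^ 2)%:R * k.+1%:R * M / total w)) * edge_weight lam I w e.
  apply: le_trans (_ : (\sum_(v | [forall x in e :\: I, ~~ conflict I x v])
      w v / total w) * (edge_weight lam I w e * \prod_(x in e) r x) <= _).
    rewrite mulr_suml big_mkcond [leRHS]big_mkcond; apply: ler_sum => v _ /=.
    have t0 : 0 <= w v / total w * (edge_weight lam I w e * \prod_(x in e) r x).
      apply: mulr_ge0 => //; apply: mulr_ge0 => //; exact: le_trans r1.
    case: ifP => ve; last by case: ifP.
    case: ifP => [_|/negbT].
      apply: ler_wpM2l => //; rewrite -big_split; apply: ler_prod => x xe.
      rewrite g'_ge0 g'_le //; by apply: contraNneq ve => <-.
    move=> /forallPn[x]; rewrite negb_imply negbK => /andP[/setDP[xe xI] xv].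
    rewrite /edge_weight (big_setD1 x) //= /boost xv add0r in_setU1 (negbTE xI).
    have -> : (x == v) = false by apply: contraNF ve => /eqP <-.
    by rewrite mulr0 mul0r mulr0.
  have Q0 : 0 <= edge_weight lam I w e * \prod_(x in e) r x.
    by apply: mulr_ge0 => //; exact: le_trans r1.
  apply: le_trans (ler_wpM2r Q0 (prob_avoid_le Hk He sh1)) _.
  rewrite [leLHS]mulrDl; set q := \prod_(x in e :\: I) (1 - load I w x).
  have -> : q * (edge_weight lam I w e * \prod_(x in e) r x) = edge_weight lam I w e.
    rewrite Er mulrCA -big_split big1 ?mulr1 // => x _ /=.
    by rewrite divff // gt_eqF //; have := load_le x; lra.
  rewrite mulrDl mul1r lerD2l.
  have c0 : 0 <= (k ^ 2)%:R * (k.+1%:R * M / total w).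
    by rewrite !mulr_ge0 ?invr_ge0.
  have -> : 2 ^+ k * ((k ^ 2)%:R * k.+1%:R * M / total w) * edge_weight lam I w e =
    (k ^ 2)%:R * (k.+1%:R * M / total w) * (edge_weight lam I w e * 2 ^+ k) by ring.
  by apply: ler_wpM2l => //; apply: ler_wpM2l.
apply: le_trans (lerD inside outside) _.
by rewrite -mulrDl ler_wpM2r //; lra.
Qed.

Lemma step_valid v : w v != 0 ->
  valid M U (v |: I) (capped M (boost I w v)).
Proof.
move=> wv0; have capped0 u : boost I w v u = 0 -> capped M (boost I w v) u = 0.
  by rewrite /capped => ->; rewrite if_same.
have boost0 u : w u = 0 -> boost I w v u = 0.
  by move=> wu; rewrite /boost wu mul0r if_same.
have dead e x : e \in H -> x \in e -> e :\ x \subset v |: I ->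
    boost I w v x = 0.
  move=> He xe sub; have [ve|ve] := boolP (v \in e :\ x); last first.
    apply: boost0; apply: (valid_blocked w_valid He xe).
    apply/subsetP => z ze; have := subsetP sub z ze; rewrite in_setU1.
    by case/orP => // /eqP zv; rewrite -zv ze in ve.
  rewrite /boost; have -> : conflict I x v = true => //.
  rewrite /conflict; apply/orP; right; apply/existsP; exists e.
  rewrite He xe; move: (ve) => /setD1P[_ ->] /=.
  apply/subsetP => z /setD1P[zv ze].
  by have := subsetP sub z ze; rewrite in_setU1 (negbTE zv).
split.
- move=> u; have [wu0|/andP[wu1 _]] := valid_range w_valid u.
    by left; apply: capped0; exact: boost0.
  rewrite /capped; case: ifP => [_|/negbT]; first by left.
  rewrite -leNgt /boost; case: ifP => [_ _|_ ->]; first by left.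
  right; rewrite andbT; have := load_le u; have := b_ge0 u => b0 b2.
  by rewrite ler_pdivlMr; lra.
- move=> u /setU1P[->|uI]; apply: capped0; first by rewrite /boost conflictxx.
  by apply: boost0; exact: (valid_chosen w_valid).
- by move=> e x He xe sub; apply: capped0; exact: (dead e).
- by move=> u uU; apply/capped0/boost0; exact: (valid_support w_valid).
- rewrite subUset (valid_sub w_valid) sub1set andbT.
  by apply: contraR wv0 => vU; rewrite (valid_support w_valid vU).
- apply/forallP => e; apply/implyP => He; apply/negP => sub.
  have [ve|ve] := boolP (v \in e).
    move/eqP: wv0; apply; apply: (valid_blocked w_valid He ve).
    apply/subsetP => z /setD1P[zv ze].
    by have := subsetP sub z ze; rewrite in_setU1 (negbTE zv).
  have /forallP/(_ e) := valid_indep w_valid; rewrite He /= => /negP; apply.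
  apply/subsetP => z ze; have := subsetP sub z ze; rewrite in_setU1.
  by case/orP => // /eqP zv; rewrite -zv ze in ve.
Qed.

(** Subtracting entropy / ln M pays in advance for the vertices that the cap
    will remove. *)
Definition potential (a lam : R) (J : {set V}) (w' : V -> R) : R :=
  total w' - entropy w' / ln M - a * pressure lam J w'.

(** Removing a vertex with weight z > M loses z in the total weight, but at
    least z in entropy / ln M. *)
Lemma potential_capped (a lam : R) v : 1 < M -> 0 <= a -> 0 <= lam ->
  potential a lam (v |: I) (boost I w v) <=
  potential a lam (v |: I) (capped M (boost I w v)).
Proof.
move=> M1 a0 lam0; have lnM : 0 < ln M by rewrite ln_gt0.
apply: lerB; last first.
  apply: ler_wpM2l => //; apply: ler_sum => e _; apply: ler_prod => x _.
  have bx := boost_ge0 v x; have lx : 0 <= lam * (x \in v |: I)%:R.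
    exact: mulr_ge0.
  by rewrite /capped; case: ifP => _; apply/andP; split; rewrite ?lerD2r //; lra.
rewrite /entropy !mulr_suml -!sumrB; apply: ler_sum => u _; rewrite /capped.
case: ifP => // Mu; rewrite !mul0r subrr.
have : ln M <= ln (boost I w v u) by rewrite ler_ln ?posrE ?ltW //; lra.
move=> h; rewrite subr_le0 -mulrA ler_peMr ?boost_ge0 //.
by rewrite ler_pdivlMr // mul1r.
Qed.

Lemma exists_ge_average (f : V -> R) (c : R) :
  c <= \sum_v w v / total w * f v -> exists2 v, w v != 0 & c <= f v.
Proof.
move=> hc; have [/existsP[v /andP[]]|/existsPn none] :=
  boolP [exists v, (w v != 0) && (c <= f v)]; first by exists v.
have pi0 v : 0 <= w v / total w by rewrite divr_ge0 // ltW.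
have lt v : w v != 0 -> w v / total w * f v < w v / total w * c.
  move=> wv; have := none v; rewrite wv /= -ltNge => h.
  by rewrite ltr_pM2l // lt_def pi0 mulf_neq0 // invr_eq0 gt_eqF.
have [v0 wv0] : exists v, w v != 0.
  apply/existsP; apply: contraTT Z_gt0 => /existsPn h.
  rewrite /total big1 ?ltxx // => v _; apply/eqP; move: (h v); by rewrite negbK.
have : \sum_v w v / total w * f v < \sum_v w v / total w * c.
  rewrite (bigD1 v0) //= [ltRHS](bigD1 v0) //= ltr_leD ?lt //.
  apply: ler_sum => v _; have [->|/lt/ltW//] := eqVneq (w v) 0.
  by rewrite !mul0r.
by rewrite -mulr_suml sum_prob mul1r ltNge hc.
Qed.

(** The coefficient of the pressure drops from a to a', which compensates both
    the growth of the pressure and its contribution to the entropy. *)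
Lemma potential_step (k : nat) (lam a a' : R) :
    uniform k H -> (2 <= k)%N -> 1 < M -> 0 < lam -> 0 <= a' ->
    (forall e x y, e \in H -> x \in e -> y \in e -> x != y ->
      (#|shared e x y| <= 1)%N) ->
    a' * (1 + 2 ^+ k * ((k ^ 2)%:R * k.+1%:R * M / total w
                        + k%:R * lam / total w)) +
      2 * (k ^ 2)%:R / (lam ^+ (k - 2) * total w * ln M) <= a ->
  exists2 v, w v != 0 &
    potential a lam I w - 2 * M / ln M <=
    potential a' lam (v |: I) (capped M (boost I w v)).
Proof.
move=> Hk k2 M1 lam0 a'0 sh1 ha; have lnM : 0 < ln M by rewrite ln_gt0.
pose f v := potential a' lam (v |: I) (boost I w v).
have [v wv hv] : exists2 v, w v != 0 & potential a lam I w - 2 * M / ln M <= f v.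
  apply: exists_ge_average.
  have -> : \sum_v w v / total w * f v =
      \sum_v w v / total w * total (boost I w v)
      - (\sum_v w v / total w * entropy (boost I w v)) / ln M
      - a' * \sum_v w v / total w * pressure lam (v |: I) (boost I w v).
    rewrite mulr_suml mulr_sumr -!sumrB; apply: eq_bigr => v _.
    by rewrite /f /potential; ring.
  rewrite average_total.
  have P0 : 0 <= pressure lam I w.
    apply: sumr_ge0 => e _; apply: prodr_ge0 => x _; apply: addr_ge0 => //.
    by apply: mulr_ge0 => //; exact: ltW.
  have hP : \sum_v w v / total w * pressure lam (v |: I) (boost I w v) <=
    (1 + 2 ^+ k * ((k ^ 2)%:R * k.+1%:R * M / total w + k%:R * lam / total w)) *
    pressure lam I w.
    under eq_bigr do rewrite mulr_sumr; rewrite exchange_big /= mulr_sumr.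
    apply: ler_sum => e He; apply: average_edge_weight => //.
    by move=> x y; exact: sh1.
  have hG := average_entropy; have hL := sum_load_le Hk k2 lam0.
  have {hG hL}hG : (\sum_v w v / total w * entropy (boost I w v)) / ln M <=
      (entropy w + 2 * (M + (k ^ 2)%:R * pressure lam I w /
          (lam ^+ (k - 2) * total w))) / ln M.
    rewrite ler_pM2r ?invr_gt0 //; apply: le_trans hG _.
    by rewrite lerD2l ler_pM2l.
  have {}ha := ler_wpM2r P0 ha.
  have {hP a'0}hP := ler_wpM2l a'0 hP; rewrite mulrA in hP.
  have E : (entropy w + 2 * (M + (k ^ 2)%:R * pressure lam I w /
          (lam ^+ (k - 2) * total w))) / ln M = entropy w / ln M + 2 * M / ln M +
     2 * (k ^ 2)%:R / (lam ^+ (k - 2) * total w * ln M) * pressure lam I w.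
    rewrite !mulrDl -!mulrA !invfM; ring.
  rewrite /potential; rewrite E in hG; rewrite mulrDl in ha; lra.
exists v => //; apply: le_trans hv _; apply: potential_capped => //; exact: ltW.
Qed.

End Step.

(** The vertices in conflict with u lie on the edges through u; a degree bound
    therefore keeps all loads small. *)
Lemma sum_conflict_le (k : nat) (M d : R) I w u : uniform k H ->
    (deg H [set u])%:R <= d -> 0 <= M -> (forall v, w v <= M) ->
    (forall v, 0 <= w v) ->
  \sum_(v | conflict I u v) w v <= (1 + k%:R * d) * M.
Proof.
move=> Hk hd M0 wM w0; pose Hu := [set e in H | [set u] \subset e].
have cover v : conflict I u v -> v \in u |: \bigcup_(e in Hu) e.
  rewrite in_setU1 => /orP[->//|/existsP[e /and4P[He ue ve _]]].
  apply/orP; right; apply/bigcupP; exists e => //.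
  by rewrite inE He sub1set.
apply: le_trans (_ : \sum_(v in u |: \bigcup_(e in Hu) e) M <= _).
  rewrite big_mkcond [leRHS]big_mkcond; apply: ler_sum => v _ /=.
  by case: ifP => [/cover ->//|_]; case: ifP.
rewrite sumr_const -[leLHS]mulr_natl ler_wpM2r //.
apply: le_trans (_ : (1 + \sum_(e in Hu) #|e|)%:R <= _).
  rewrite ler_nat cardsU1; apply: leq_add; first by case: (_ \notin _).
  apply: (big_ind2 (fun (X : {set V}) n => #|X| <= n)%N) => //.
    by rewrite cards0.
  move=> X a Y b hX hY.
  exact: leq_trans (leq_card_setU _ _).1 (leq_add hX hY).
rewrite (eq_bigr (fun=> k)) => [|e]; last by rewrite inE => /andP[/Hk].
rewrite sum_nat_const natrD natrM mulrC lerD2l ler_wpM2l //.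
Qed.

Lemma sum_deg (U : {set V}) : (forall e, e \in H -> e \subset U) ->
  (\sum_(u in U) deg H [set u] = \sum_(e in H) #|e|)%N.
Proof.
move=> HU; rewrite /deg; under eq_bigr do rewrite -sum1_card.
rewrite (exchange_big_dep (mem H)) /=; last by move=> u e _; rewrite inE => /andP[].
apply: eq_bigr => e He; rewrite -sum1_card; apply: eq_bigl => u.
rewrite inE He sub1set andTb; apply/andP/idP => [[]//|ue]; split=> //.
exact: (subsetP (HU e He)).
Qed.

Lemma card_edges_le (k : nat) (d : R) (U : {set V}) : uniform k H -> (0 < k)%N ->
    (forall e, e \in H -> e \subset U) ->
    (forall u, (deg H [set u])%:R <= d) ->
  #|H|%:R <= d * #|U|%:R.
Proof.
move=> Hk k0 HU hd.
apply: le_trans (_ : \sum_(u in U) (deg H [set u])%:R <= _); last first.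
  by rewrite mulrC mulr_natl -sumr_const; apply: ler_sum.
rewrite -natr_sum ler_nat sum_deg // -sum1_card.
by apply: leq_sum => e /Hk ->.
Qed.

(** With lam = N / m and M <= N / m, a step multiplies the pressure on average by
    at most 1 + growth k / m, as long as the total weight is at least N / 2. *)
Definition growth (k : nat) : R := 2 ^+ k.+1 * ((k ^ 2)%:R * k.+1%:R + k%:R).

(** The coefficient of the pressure with r steps to go is D m q^r, where D is
    the entropy, in units of ln M, created in a step per unit of pressure and
    q = 1 + (growth k + 1) / m.  The extra 1 / m in q leaves D q^r in each step to
    pay for that entropy.  The first numerical
    bound keeps the loads at most 1/2, the second makes the correlations negligible, and
    the last two say that the entropy from the chosen vertices themselves and the
    initial pressure each take at most a quarter of the N units of weight. *)
Lemma weighted_greedy (k m : nat) (U : {set V}) (M d : R) :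
  uniform k H -> (2 <= k)%N ->
  (forall e, e \in H -> e \subset U) ->
  (forall e x y, e \in H -> x \in e -> y \in e -> x != y ->
     (#|shared e x y| <= 1)%N) ->
  (forall u, (deg H [set u])%:R <= d) ->
  1 < M -> (0 < m)%N ->
  (1 + k%:R * d) * M <= #|U|%:R / 4 ->
  M * m%:R <= #|U|%:R ->
  2 * M * m%:R <= ln M * (#|U|%:R / 4) ->
  16 * (k ^ 2)%:R * expR (growth k + 1) * d * m%:R <=
    #|U|%:R * (#|U|%:R / m%:R) ^+ (k - 2) * ln M ->
  exists I : {set V}, [/\ I \subset U, independent H I & #|I| = m].
Proof.
move=> Hk k2 HU sh1 hd M1 m0 h1 h2 h3 h4.
set N : R := #|U|%:R in h1 h2 h3 h4 *.
have mR : 0 < m%:R :> R by rewrite ltr0n.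
have M0 : 0 < M by lra.
have N0 : 0 < N by apply: lt_le_trans h2; exact: mulr_gt0.
have lnM : 0 < ln M by rewrite ln_gt0.
pose lam := N / m%:R; have lam0 : 0 < lam by exact: divr_gt0.
have lk0 : 0 < lam ^+ (k - 2) by rewrite exprn_gt0.
pose C := growth k; have C0 : 0 <= C.
  by rewrite /C /growth mulr_ge0 ?exprn_ge0 // addr_ge0 ?mulr_ge0.
pose q := 1 + (C + 1) / m%:R.
have q1 : 1 <= q by rewrite lerDl divr_ge0 ?ltW //; lra.
have qm : q ^+ m <= expR (C + 1).
  have -> : C + 1 = (C + 1) / m%:R * m%:R by rewrite divfK // gt_eqF.
  rewrite expRM_natr lerXn2r ?nnegrE ?expR_ge0 ?expR_ge1Dx //.
  exact: le_trans q1.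
pose D := 4 * (k ^ 2)%:R / (lam ^+ (k - 2) * N * ln M).
have D0 : 0 <= D by rewrite divr_ge0 ?mulr_ge0 // ltW // !mulr_gt0.
pose a i := D * m%:R * q ^+ (m - i).
have a_ge0 j : 0 <= a j.
  by apply: mulr_ge0; [exact: mulr_ge0|apply: exprn_ge0; exact: le_trans q1].
pose w0 v : R := (v \in U)%:R.
have total0 : total w0 = N.
  rewrite /total /w0 (bigID (mem U)) /= [X in _ + X]big1 ?addr0.
    by rewrite (eq_bigr (fun=> 1)) => [|v ->//]; rewrite sumr_const.
  by move=> v /negbTE->.
have entropy0 : entropy w0 = 0.
  rewrite /entropy big1 // => u _; rewrite /w0.
  by case: (u \in U); rewrite ?ln1 ?mulr0 ?mul0r.
have pressure0 : pressure lam set0 w0 <= #|H|%:R.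
  rewrite -sum1_card natr_sum; apply: ler_sum => e _.
  rewrite -[leRHS](expr1n _ #|e|) -prodr_const; apply: ler_prod => x _.
  by rewrite in_set0 mulr0 addr0 /w0; case: (x \in U); rewrite ?lexx ?ler01.
have dN := card_edges_le Hk (ltnW k2) HU hd; rewrite -/N in dN.
have start : N - N / 4 <= potential M (a 0) lam set0 w0.
  rewrite /potential total0 entropy0 mul0r subr0 lerD2l lerN2.
  apply: le_trans (ler_wpM2l (a_ge0 0) (le_trans pressure0 dN)) _.
  have dN0 : 0 <= d * N := le_trans (ler0n _ _) dN.
  have Dm0 : 0 <= D * m%:R by rewrite mulr_ge0.
  rewrite /a subn0; apply: le_trans (ler_wpM2r dN0 (ler_wpM2l Dm0 qm)) _.
  have -> : D * m%:R * expR (C + 1) * (d * N) =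
      4 * (k ^ 2)%:R * expR (C + 1) * d * m%:R / (lam ^+ (k - 2) * ln M).
    by rewrite /D; field; rewrite ?gt_eqF.
  by rewrite ler_pdivrMr ?mulr_gt0 // -/C -/lam in h4 *; lra.
have valid0 : valid M U set0 w0.
  split.
  - by move=> u; rewrite /w0; case: (u \in U); [right; rewrite lexx ltW|left].
  - by move=> u; rewrite in_set0.
  - move=> e x He xe sub; have := subset_leq_card sub; rewrite cards0.
    rewrite leqn0 => /eqP c0; have := cardsD1 x e; rewrite xe c0 (Hk _ He) => ck.
    by move: (k2); rewrite ck.
  - by move=> u /negbTE uU; rewrite /w0 uU.
  - exact: sub0set.
  - apply/forallP => e; apply/implyP => He; apply/negP => /subset_leq_card.
    by rewrite cards0 (Hk _ He) => /(leq_trans k2).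
have loss i : (i <= m)%N -> i%:R * (2 * M / ln M) <= N / 4.
  move=> im; apply: le_trans (_ : m%:R * (2 * M / ln M) <= _).
    by rewrite ler_wpM2r ?ler_nat // divr_ge0 ?mulr_ge0 // ltW.
  by rewrite mulrA ler_pdivrMr //; lra.
have run i : (i <= m)%N -> exists I w, [/\ valid M U I w, #|I| = i &
    N - N / 4 - i%:R * (2 * M / ln M) <= potential M (a i) lam I w].
  elim: i => [_|i IH im].
    by exists set0, w0; rewrite cards0 mul0r subr0.
  have [I [w [wv cI pot]]] := IH (ltnW im).
  have w_ge0 u : 0 <= w u by case: (valid_range wv u) => [->//|/andP[+ _]]; lra.
  have ent0 : 0 <= entropy w / ln M.
    apply: divr_ge0; last exact: ltW.
    apply: sumr_ge0 => u _; case: (valid_range wv u) => [->|/andP[w1 _]].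
      by rewrite mul0r.
    by rewrite mulr_ge0 // ln_ge0.
  have pr0 : 0 <= pressure lam I w.
    apply: sumr_ge0 => e _; apply: prodr_ge0 => x _; apply: addr_ge0 => //.
    by apply: mulr_ge0 => //; exact: ltW.
  have ZN : N / 2 <= total w.
    have := mulr_ge0 (a_ge0 i) pr0; have := loss _ (ltnW im).
    move: pot; rewrite /potential => *; lra.
  have Z0 : 0 < total w by lra.
  have ld u : load I w u <= 2^-1.
    rewrite /load ler_pdivrMr //.
    have := sum_conflict_le I Hk (hd u) (ltW M0) (weight_le (ltW M1) wv) w_ge0.
    by lra.
  have [|v wv0 hv] := potential_step (a := a i) (ltW M1) wv Z0 ld Hk k2 M1 lam0
    (a_ge0 i.+1) sh1.
    have inv2 : (total w)^-1 <= 2 / N.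
      by rewrite -[2 / N]invf_div lef_pV2 ?posrE ?divr_gt0.
    have c1 : M / total w <= 2 / m%:R.
      apply: le_trans (ler_wpM2l (ltW M0) inv2) _.
      by rewrite mulrCA ler_pM2l // ler_pdivrMr // mulrC ler_pdivlMr.
    have c2 : lam / total w <= 2 / m%:R.
      apply: le_trans (ler_wpM2l (ltW lam0) inv2) _.
      by rewrite /lam mulrCA ler_pM2l // mulrAC divff ?mul1r // gt_eqF.
    have gr : 1 + 2 ^+ k * ((k ^ 2)%:R * k.+1%:R * M / total w +
        k%:R * lam / total w) <= 1 + C / m%:R.
      have -> : C / m%:R = 2 ^+ k *
          ((k ^ 2)%:R * (k.+1%:R * (2 / m%:R)) + k%:R * (2 / m%:R)).
        by rewrite /C /growth exprSr; ring.
      rewrite lerD2l ler_wpM2l ?exprn_ge0 // -!mulrA lerD //.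
        by apply: ler_wpM2l => //; apply: ler_wpM2l.
      by apply: le_trans (ler_wpM2l (ler0n R k) c2); rewrite /lam !mulrA.
    have gD : 2 * (k ^ 2)%:R / (lam ^+ (k - 2) * total w * ln M) <= D.
      have := ler_wpM2l (_ : 0 <= 2 * (k ^ 2)%:R / (lam ^+ (k - 2) * ln M)) inv2.
      have -> : 2 * (k ^ 2)%:R / (lam ^+ (k - 2) * ln M) * (2 / N) = D.
        by rewrite /D; field; rewrite ?gt_eqF.
      have -> : 2 * (k ^ 2)%:R / (lam ^+ (k - 2) * ln M) / total w =
          2 * (k ^ 2)%:R / (lam ^+ (k - 2) * total w * ln M).
        by field; rewrite ?gt_eqF.
      by apply; rewrite divr_ge0 ?mulr_ge0 // ltW // mulr_gt0.
    apply: le_trans (lerD (ler_wpM2l (a_ge0 _) gr) gD) _.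
    rewrite /a -(subnSK im) exprSr; set r := q ^+ _.
    have r1 : 1 <= r by rewrite exprn_ege1.
    have -> : D * m%:R * (r * q) = D * m%:R * r * (1 + C / m%:R) + D * r.
      by rewrite /q; field; rewrite gt_eqF.
    by rewrite lerD2l ler_peMr.
  exists (v |: I), (capped M (boost I w v)); split.
  - exact: step_valid.
  - rewrite cardsU1 cI; have -> : v \notin I => //.
    by apply: contra wv0 => vI; rewrite (valid_chosen wv vI).
  - have -> : i.+1%:R * (2 * M / ln M) = i%:R * (2 * M / ln M) + 2 * M / ln M.
      by rewrite -natr1 mulrDl mul1r.
    by apply: le_trans hv; rewrite opprD addrA lerD2r.
have [I [w [wv cI _]]] := run m (leqnn m).
by exists I; split; [exact: valid_sub wv|exact: valid_indep wv|].
Qed.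

End WeightedGreedy.
(** * Excluded configurations *)

Section Cleaning.
Variables (V : finType) (k : nat).
Implicit Types (H : {set {set V}}) (e f a b c X S : {set V}).

Definition bad_pair e f : bool := (2 <= #|e :&: f| <= k - 2)%N.

(** A loose triangle, or a pair of edges with many common vertices that is
    closed up by a third edge: the edges a and b form a connected set, and c
    returns to it in two vertices. *)
Definition bad_triple a b c : bool :=
  [&& a != b, a :&: b != set0 & #|c :&: (a :|: b)| == 2].

(** Being distinct rules out k common vertices, and the absence of bad pairs
    rules out 2 to k - 2; the two cases left are treated very differently. *)
Lemma meet_size H e f x : uniform k H -> e \in H -> f \in H -> e != f ->
    x \in e -> x \in f -> ~~ bad_pair e f ->
  #|e :&: f| = 1 \/ #|e :&: f| = k.-1.
Proof.
move=> Hk He Hf ef xe xf; rewrite /bad_pair => nb.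
have h1 : (0 < #|e :&: f|)%N by apply/card_gt0P; exists x; rewrite inE xe.
have h2 : (#|e :&: f| < k)%N.
  rewrite -(Hk _ He); apply: proper_card; rewrite properE subsetIl subsetI subxx /=.
  apply: contra ef => sub; rewrite eqEcard sub (Hk _ He) (Hk _ Hf) leqnn //.
move: nb h1 h2; move: #|e :&: f| => n; lia.
Qed.

Lemma tight_meet H e f y v : uniform k H -> e \in H -> f \in H ->
    y \in e -> y \notin f -> v \in f -> v \notin e -> #|e :&: f| = k.-1 ->
  f :&: e = e :\ y /\ f :\: e = [set v].
Proof.
move=> Hk He Hf ye yf vf ve c; split.
  apply/eqP; rewrite eqEcard; apply/andP; split.
    apply/subsetP => z; rewrite !inE => /andP[zf ->]; rewrite andbT.
    by apply: contraNneq yf => <-.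
  have := cardsD1 y e; rewrite ye (Hk _ He) setIC c => ->; by rewrite add1n.
apply/esym/eqP; rewrite eqEcard sub1set inE ve vf cards1 /=.
have := cardsID e f; rewrite setIC c (Hk _ Hf).
have : (0 < k)%N by rewrite -(Hk _ He); apply/card_gt0P; exists y.
lia.
Qed.

(** Let f through x, f' through y show that v is shared.  If both meet e in one
    vertex, then (f, f', e) is a bad triple; if only f is tight to e, then (e, f, f')
    is one, since f' meets their union exactly in y and v.  So f = e - y + v and
    f' = e - x + v.  Two different vertices v1, v2 of this kind would give the edges
    e - y + v1 and e - x + v2, which have k - 2 >= 2 common vertices and form a bad
    pair. *)
Lemma shared_le1 H e x y : uniform k H -> (4 <= k)%N ->
    (forall e f, e \in H -> f \in H -> ~~ bad_pair e f) ->
    (forall a b c, a \in H -> b \in H -> c \in H -> ~~ bad_triple a b c) ->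
    e \in H -> x \in e -> y \in e -> x != y ->
  (#|shared H e x y| <= 1)%N.
Proof.
move=> Hk k4 nopair notriple He xe ye xy.
have meet2 (X Y : {set V}) p q : X = [set p] -> Y = [set q] -> p != q ->
    #|X :|: Y| = 2 by move=> -> -> pq; rewrite cards2 pq.
have one X p : #|X| = 1 -> p \in X -> X = [set p].
  move=> /eqP/cards1P[z ->]; by rewrite inE => /eqP->.
have tight v : v \in shared H e x y -> exists f f', [/\ f \in H, f' \in H &
    [/\ f :&: e = e :\ y, f :\: e = [set v], f' :&: e = e :\ x &
        f' :\: e = [set v]]].
  rewrite inE => /and3P[ve /existsP[f /and4P[Hf xf vf yf]]].
  move=> /existsP[f' /and4P[Hf' yf' vf' xf']].
  have ef : e != f by apply: contraNneq yf => <-.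
  have ef' : e != f' by apply: contraNneq xf' => <-.
  have ff' : f != f' by apply: contraNneq yf => ->.
  have vx : x != v by apply: contraNneq ve => <-.
  have vy : y != v by apply: contraNneq ve => <-.
  have m1 := meet_size Hk He Hf ef xe xf (nopair _ _ He Hf).
  have m2 := meet_size Hk He Hf' ef' ye yf' (nopair _ _ He Hf').
  have tf := tight_meet Hk He Hf ye yf vf ve.
  have tf' := tight_meet Hk He Hf' xe xf' vf' ve.
  have mixed g g' z z' : g \in H -> g' \in H -> e != g -> z \in e -> z \in g ->
      z' \in e -> z' \in g' -> v \in g' -> z' != v -> z' \notin g ->
      #|e :&: g'| = 1 -> g :\: e = [set v] -> False.
    move=> Hg Hg' eg ze zg z'e z'g' vg' z'v z'g c1 gv.
    have /negP := notriple _ _ _ He Hg Hg'; apply.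
    rewrite /bad_triple eg /=; apply/andP; split.
      by apply/set0Pn; exists z; rewrite inE ze.
    have -> : g' :&: (e :|: g) = [set z'] :|: [set v].
      have E1 : e :&: g' = [set z'] by apply: one; rewrite // inE z'e.
      rewrite -gv -E1; apply/setP => z0; rewrite !inE.
      have [z0e|z0e] := boolP (z0 \in e); have [z0g'|z0g'] := boolP (z0 \in g');
        rewrite ?andbT ?andbF ?orbF //=.
      apply/esym/negbTE/negP => z0g.
      have : z0 \in g :\: e by rewrite inE z0e z0g.
      by rewrite gv inE => /eqP z0v; rewrite z0v vg' in z0g'.
    by rewrite cards2 z'v.
  case: m1 => [c1|/tf [A B]]; case: m2 => [c2|/tf' [A' B']].
  - exfalso; have /negP := notriple _ _ _ Hf Hf' He; apply.
    rewrite /bad_triple ff' /=; apply/andP; split.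
      by apply/set0Pn; exists v; rewrite inE vf.
    rewrite setIUr (meet2 _ _ x y) //; by apply: one; rewrite // inE ?xe ?ye.
  - by exfalso; exact: (mixed f' f y x).
  - by exfalso; exact: (mixed f f' x y).
  - by exists f, f'.
rewrite leqNgt; apply/negP => /card_gt1P[v1 [v2 [/tight[f [_ [Hf _ [A B _ _]]]]]]].
move=> /tight[_ [f' [_ Hf' [_ _ A' B']]]] v12.
have /negP := nopair _ _ Hf Hf'; apply; rewrite /bad_pair.
have -> : f :&: f' = e :\ x :\ y.
  apply/setP => z; have /setP/(_ z) := A; have /setP/(_ z) := B.
  have /setP/(_ z) := A'; have /setP/(_ z) := B'; rewrite !inE.
  case: (z \in e); rewrite /= ?andbT ?andbF.
    by move=> _ -> _ ->; rewrite andbC.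
  move=> -> _ -> _; apply/negbTE; apply: contra v12 => /andP[/eqP<- /eqP<-] //.
have := cardsD1 x e; have := cardsD1 y (e :\ x).
rewrite !inE xe ye eq_sym xy (Hk _ He) /=; move: #|_ :\ y| => n; lia.
Qed.

Lemma hitting_set (F : {set {set V}}) : set0 \notin F ->
  exists2 X : {set V}, (#|X| <= #|F|)%N & forall e, e \in F -> ~~ [disjoint e & X].
Proof.
move=> F0; pose r e : {set V} := [set v | [pick v in e] == Some v].
exists (\bigcup_(e in F) r e).
  rewrite -[leqRHS]sum1_card; apply: (big_ind2 (fun (X : {set V}) n => #|X| <= n)%N).
  - by rewrite cards0.
  - move=> X m Y n hX hY.
    exact: leq_trans (leq_card_setU _ _).1 (leq_add hX hY).
  - move=> e _; apply/card_le1P => v; rewrite inE => /eqP pv w.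
    by rewrite !inE pv; apply/eqP/eqP => [[->]|->].
move=> e eF; have : e != set0 by apply: contraNneq F0 => <-.
move=> /set0Pn[z ze].
have pv : [pick u in e] != None.
  by case: pickP => // /(_ z); rewrite ze.
apply/pred0Pn; case Ep: [pick u in e] pv => [u|//] _; exists u.
rewrite /= (_ : u \in e); last by case: pickP Ep => // u' u'e [<-].
by apply/bigcupP; exists e; rewrite // inE Ep.
Qed.
End Cleaning.

(** * Random subsets *)

Section RandomSubset.
Variables (R : realType) (V : finType) (p : R).
Hypothesis p01 : 0 <= p <= 1.
Implicit Types (W X : {set V}) (f : {set V} -> R).

Definition subset_prob W : R := \prod_v (if v \in W then p else 1 - p).

Definition expect f : R := \sum_W subset_prob W * f W.

(** Expand the product over all v of (p + g v), where g v = 0 on X and 1 - p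
    elsewhere: exactly the subsets that contain X survive. *)
Lemma expect_subset X : expect (fun W => (X \subset W)%:R) = p ^+ #|X|.
Proof.
have -> : p ^+ #|X| = \prod_v (p + (if v \in X then 0 else 1 - p)).
  rewrite [RHS](bigID (mem X)) /= [X in _ * X]big1 ?mulr1.
    by rewrite -prodr_const; apply: eq_bigr => v ->; rewrite addr0.
  by move=> v /negbTE->; rewrite addrC subrK.
rewrite bigA_distr; apply: eq_bigr => W _; rewrite /subset_prob.
have [sub|/subsetPn[x xX xW]] := boolP (X \subset W).
  rewrite mulr1; apply: eq_bigr => v _; case: ifPn => // vW.
  by rewrite ifN //; apply: contra vW; exact: (subsetP sub).
by rewrite mulr0 (bigD1 x) //= (negbTE xW) xX mul0r.
Qed.

Lemma expect_sum (J : finType) (P : pred J) (F : J -> {set V} -> R) :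
  expect (fun W => \sum_(j | P j) F j W) = \sum_(j | P j) expect (F j).
Proof.
by rewrite /expect exchange_big; apply: eq_bigr => W _; rewrite mulr_sumr.
Qed.

Lemma expectB f g : expect (fun W => f W - g W) = expect f - expect g.
Proof. by rewrite /expect -sumrB; apply: eq_bigr => W _; rewrite mulrBr. Qed.

Lemma expectD f g : expect (fun W => f W + g W) = expect f + expect g.
Proof. by rewrite /expect -big_split; apply: eq_bigr => W _; rewrite mulrDr. Qed.

Lemma expectZ c f : expect (fun W => c * f W) = c * expect f.
Proof. by rewrite /expect mulr_sumr; apply: eq_bigr => W _; rewrite mulrCA. Qed.

Lemma expect_ex f (c : R) : c <= expect f -> exists W, c <= f W.
Proof.
move=> hc; apply/existsP; apply: contraLR hc => /existsPn hf; rewrite -ltNge.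
have prob_ge0 W : 0 <= subset_prob W.
  by have /andP[? ?] := p01; apply: prodr_ge0 => v _; case: ifP => _; lra.
have prob1 : \sum_W subset_prob W = 1.
  have := expect_subset set0; rewrite cards0 expr0 => <-.
  by apply: eq_bigr => W _; rewrite sub0set mulr1.
have [W W0] : exists W, subset_prob W != 0.
  apply/existsP; apply: contraT => /existsPn h; move: prob1.
  rewrite big1 => [/esym/eqP|W _]; first by rewrite oner_eq0.
  by apply/eqP; have := h W; rewrite negbK.
rewrite -[c]mul1r -prob1 mulr_suml /expect (bigD1 W) //= [ltRHS](bigD1 W) //=.
apply: ltr_leD; last first.
  by apply: ler_sum => W' _; apply: ler_wpM2l => //; rewrite ltW // ltNge hf.
have fW : f W < c by rewrite ltNge hf.
by rewrite ltr_pM2l // lt_def W0 prob_ge0.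
Qed.

End RandomSubset.

(** * Passing to a clean induced subhypergraph *)

Section Sparsification.
Variables (R : realType) (V : finType) (k : nat) (H : {set {set V}}).
Hypothesis Hk : uniform k H.
Implicit Types (e f a b c X S U W : {set V}).

Definition induced U : {set {set V}} := [set e in H | e \subset U].

(** Sort the edges c by their trace S on X.  There are at most deg S edges with
    trace S, and each adds k - |S| new vertices. *)
Lemma extension_weight (p q : R) X (Q : pred nat) : 0 <= p ->
    (forall S, S \subset X -> Q #|S| -> (deg H S)%:R * p ^+ (k - #|S|) <= q) ->
    0 <= q ->
  \sum_(c in H | Q #|c :&: X|) p ^+ #|c :\: X| <= 2 ^+ #|X| * q.
Proof.
move=> p0 hq q0.
rewrite (partition_big (fun c => c :&: X) (mem (powerset X))) /=; last first.
  by move=> c _; rewrite powersetE subsetIr.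
rewrite -natrX -card_powerset mulr_natl -sumr_const.
apply: ler_sum => S; rewrite powersetE => SX.
have [QS|QS] := boolP (Q #|S|); last first.
  rewrite big_pred0 // => c; apply/negbTE/negP => /andP[/andP[_ Qc] /eqP cS].
  by rewrite -cS Qc in QS.
apply: le_trans (hq S SX QS); rewrite mulr_natl -sumr_const.
rewrite big_mkcond [leRHS]big_mkcond; apply: ler_sum => c _ /=.
case: ifP => [/andP[/andP[Hc _] /eqP cS]|_]; last first.
  by case: ifP => // _; rewrite exprn_ge0.
rewrite inE Hc -{1}cS subsetIl /=.
by rewrite -cS -(Hk Hc) -(cardsID X c) addKn.
Qed.

(** First moment method and deletion.  In expectation a sample has n p vertices
    with p = T / t, at most n p T^(k-1) edges, and at most n p / 8 bad pairs and
    triples.  The score, which subtracts from the number of vertices the bad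
    configurations and a multiple of the edges, bounds the latter two at the same
    time.  After one vertex of each bad configuration is deleted, the average
    degree is O(T^(k-1)), and dropping the vertices of more than twice the average
    degree costs at most half of the vertices. *)
Lemma clean_sample (t T tau : R) : (4 <= k)%N -> 1 <= T -> T <= t -> 0 < tau ->
    (forall S, (0 < #|S| < k)%N -> (deg H S)%:R <= t ^+ (k - #|S|)) ->
    (forall S, (2 <= #|S| <= k - 2)%N ->
       (deg H S)%:R * tau <= t ^+ (k - #|S|)) ->
    16 * 8 ^+ k * T ^+ (3 * k) <= tau ->
  exists U, [/\ #|V|%:R * (T / t) / 4 <= #|U|%:R :> R,
    forall u, (deg (induced U) [set u])%:R <= 8 * k%:R * T ^+ (k - 1),
    forall e f, e \in induced U -> f \in induced U -> ~~ bad_pair k e f &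
    forall a b c, a \in induced U -> b \in induced U -> c \in induced U ->
      ~~ bad_triple a b c].
Proof.
move=> k4 T1 Tt tau0 hdeg hdeg2 htau.
have k3 : (k - 1 + 2 * k <= 3 * k)%N by lia.
have t0 : 0 < t by lra.
pose p := T / t; have p01 : 0 <= p <= 1.
  by rewrite /p divr_ge0 ?ler_pdivrMr ?mul1r //; lra.
have p0 : 0 <= p by case/andP: p01.
have pt : t * p = T by rewrite /p mulrC divfK // gt_eqF.
rewrite -/p; clearbody p.
have T0 : 0 <= T by lra.
have Tk0 j : 0 < T ^+ j by rewrite exprn_gt0 //; lra.
have Tk1 j : 1 <= T ^+ j by rewrite exprn_ege1.
set n : R := #|V|%:R.
have n0 : 0 <= n by exact: ler0n.
have cardH : #|H|%:R <= t ^+ (k - 1) * n.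
  rewrite /n -cardsT; apply: (card_edges_le Hk); first exact: leq_trans k4.
    by move=> e _; exact: subsetT.
  by move=> u; have := hdeg [set u]; rewrite cards1; apply; lia.
(* the expected number of edges in the sample *)
have mass : #|H|%:R * p ^+ k <= n * p * T ^+ (k - 1).
  apply: le_trans (ler_wpM2r (exprn_ge0 k p0) cardH) _.
  rewrite -pt exprMn (_ : p ^+ k = p ^+ (k - 1) * p); last first.
    by rewrite -exprSr; congr (_ ^+ _); lia.
  rewrite le_eqVlt; apply/orP; left; apply/eqP; ring.
have ext1 X : \sum_(c in H | (0 < #|c :&: X| < k)%N) p ^+ #|c :\: X| <=
    2 ^+ #|X| * T ^+ k.
  apply: (extension_weight (Q := fun j => (0 < j < k)%N)) => // [S _ QS|]; last first.
    exact: exprn_ge0.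
  apply: le_trans (ler_wpM2r (exprn_ge0 _ p0) (hdeg _ QS)) _.
  by rewrite -exprMn pt ler_weXn2l // leq_subr.
have ext2 X (Q : pred nat) : (forall j, Q j -> (2 <= j <= k - 2)%N) ->
    \sum_(c in H | Q #|c :&: X|) p ^+ #|c :\: X| <= 2 ^+ #|X| * (T ^+ k / tau).
  move=> hQ; apply: extension_weight => // [S _ /hQ QS|]; last first.
    by rewrite divr_ge0 ?ltW.
  rewrite ler_pdivlMr // mulrAC.
  apply: le_trans (ler_wpM2r (exprn_ge0 _ p0) (hdeg2 _ QS)) _.
  by rewrite -exprMn pt ler_weXn2l // leq_subr.
pose pairs W e : R := \sum_(f in H | bad_pair k e f) (e :|: f \subset W)%:R.
pose triples W a : R := \sum_(b in H | (a != b) && (a :&: b != set0))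
   \sum_(c in H | #|c :&: (a :|: b)| == 2) (a :|: b :|: c \subset W)%:R.
pose edges W : R := \sum_(e in H) (e \subset W)%:R.
have pU X Y : p ^+ #|X :|: Y| = p ^+ #|X| * p ^+ #|Y :\: X| :> R.
  rewrite -exprD; congr (_ ^+ _).
  by rewrite -(cardsID X (X :|: Y)) setUK setDUl setDv set0U.
have Epairs e : e \in H ->
    expect p (fun W => pairs W e) <= p ^+ k * (2 ^+ k * (T ^+ k / tau)).
  move=> He; rewrite expect_sum.
  under eq_bigr do rewrite expect_subset pU (Hk He).
  rewrite -mulr_sumr ler_wpM2l ?exprn_ge0 //.
  have := ext2 e (fun j => (2 <= j <= k - 2)%N) (fun _ h => h).
  by rewrite (Hk He); under [in X in X -> _]eq_bigl do rewrite setIC.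
have Etriples a : a \in H -> expect p (fun W => triples W a) <=
    p ^+ k * (8 ^+ k * (T ^+ (2 * k) / tau)).
  move=> Ha; rewrite expect_sum.
  apply: le_trans (_ : \sum_(b in H | (a != b) && (a :&: b != set0))
     p ^+ k * p ^+ #|b :\: a| * (4 ^+ k * (T ^+ k / tau)) <= _).
    apply: ler_sum => b /and3P[Hb ab _]; rewrite expect_sum.
    under eq_bigr do rewrite expect_subset pU pU (Hk Ha).
    rewrite -mulr_sumr ler_wpM2l ?mulr_ge0 ?exprn_ge0 //.
    have := ext2 (a :|: b) (fun j => j == 2).
    move=> /(_ _)/le_trans -> //; first by move=> j /eqP->; rewrite leqnn leq_subRL ?(leq_trans _ k4).
    apply: ler_wpM2r; first by rewrite divr_ge0 // ltW.
    rewrite (_ : 4 = 2 ^+ 2 :> R) -?exprM; last by ring.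
    rewrite ler_weXn2l ?ler1n // (leq_trans (leq_card_setU _ _).1) //.
    by rewrite (Hk Ha) (Hk Hb) addnn mul2n.
  rewrite -mulr_suml -mulr_sumr -mulrA ler_wpM2l ?exprn_ge0 //.
  have -> : 8 ^+ k * (T ^+ (2 * k) / tau) =
      2 ^+ k * T ^+ k * (4 ^+ k * (T ^+ k / tau)).
    rewrite (_ : 8 = 2 * 4 :> R); last by ring.
    by rewrite exprMn mul2n -addnn exprD; ring.
  apply: ler_wpM2r.
    by rewrite mulr_ge0 ?exprn_ge0 // divr_ge0 // ltW.
  have := ext1 a; rewrite (Hk Ha); apply: le_trans.
  rewrite big_mkcond [leRHS]big_mkcond; apply: ler_sum => b _ /=.
  case: ifP => [/and3P[Hb ab abI]|_]; last by case: ifP; rewrite ?exprn_ge0.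
  rewrite Hb setIC card_gt0 abI /= ifT // -(Hk Ha); apply: proper_card.
  rewrite properE subsetIl subsetI subxx /=; apply: contra ab => sub.
  by rewrite eqEcard sub (Hk Ha) (Hk Hb) leqnn.
pose kap := (4 * T ^+ (k - 1))^-1; have kap0 : 0 < kap.
  by rewrite invr_gt0 mulr_gt0.
pose verts W : R := \sum_v ([set v] \subset W)%:R.
pose bad W : R := \sum_(e in H) (pairs W e + triples W e).
have Everts : expect p verts = n * p.
  rewrite expect_sum (eq_bigr (fun=> p)) => [|v _]; last first.
    by rewrite expect_subset cards1 expr1.
  by rewrite sumr_const mulr_natl.
have Eedges : expect p edges = #|H|%:R * p ^+ k.
  rewrite expect_sum (eq_bigr (fun=> p ^+ k)) => [|e He]; last first.
    by rewrite expect_subset (Hk He).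
  by rewrite sumr_const mulr_natl.
have Ebad : expect p bad <= n * p / 8.
  rewrite expect_sum.
  apply: le_trans (_ : \sum_(e in H) p ^+ k * (2 * 8 ^+ k * T ^+ (2 * k) / tau) <= _).
    apply: ler_sum => e He.
    rewrite (expectD p (fun W => pairs W e) (fun W => triples W e)).
    apply: le_trans (lerD (Epairs e He) (Etriples e He)) _.
    rewrite -mulrDr ler_wpM2l ?exprn_ge0 //.
    have h28 : 2 ^+ k <= 8 ^+ k :> R by rewrite lerXn2r ?nnegrE // ler_nat.
    have hT : T ^+ k <= T ^+ (2 * k) by rewrite ler_weXn2l // leq_pmull.
    have : 2 ^+ k * (T ^+ k / tau) <= 8 ^+ k * (T ^+ (2 * k) / tau).
      apply: ler_pM => //; first by rewrite exprn_ge0.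
      - by rewrite divr_ge0 // ltW.
      - by rewrite ler_pM2r // invr_gt0.
    by rewrite -!mulrA; lra.
  rewrite sumr_const -[leLHS]mulr_natl mulrA.
  have b0 : 0 <= 2 * 8 ^+ k * T ^+ (2 * k) / tau.
    by rewrite divr_ge0 ?mulr_ge0 ?exprn_ge0 // ltW.
  apply: le_trans (ler_wpM2r b0 mass) _.
  rewrite -!mulrA ler_wpM2l // ler_wpM2l // !mulrA ler_pdivrMr //.
  have hT : T ^+ (k - 1) * T ^+ (2 * k) <= T ^+ (3 * k).
    by rewrite -exprD ler_weXn2l.
  have := ler_wpM2l (exprn_ge0 k (ler0n R 8)) hT; lra.
have [W hW] : exists W, n * p / 2 <= verts W - bad W - kap * edges W.
  apply: (expect_ex p01).
  rewrite (expectB p (fun W => verts W - bad W) (fun W => kap * edges W)).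
  rewrite (expectB p verts bad) (expectZ p kap edges) Everts Eedges.
  have : kap * (#|H|%:R * p ^+ k) <= n * p / 4.
    apply: le_trans (ler_wpM2l (ltW kap0) mass) _.
    have -> : kap * (n * p * T ^+ (k - 1)) = n * p / 4 => //.
    by rewrite /kap; field; rewrite gt_eqF.
  have : 0 <= n * p by rewrite mulr_ge0.
  by move: Ebad; set x := expect _ _; set y := kap * _; lra.
(* deleting a vertex of the first edge destroys a bad pair or triple *)
pose first e := (e \subset W) &&
  ([exists f in H, bad_pair k e f && (f \subset W)] ||
   [exists b in H, exists c in H, [&& bad_triple e b c, b \subset W & c \subset W]]).
pose F := [set e in H | first e].
have cF : #|F|%:R <= bad W.
  rewrite -sum1_card natr_sum big_mkcond /bad [leRHS]big_mkcond /=.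
  apply: ler_sum => e _; rewrite inE; case: (boolP (e \in H)) => //= He.
  have P0 : 0 <= pairs W e by apply: sumr_ge0.
  have Q0 : 0 <= triples W e by apply: sumr_ge0 => b _; apply: sumr_ge0.
  case: ifP => [/andP[eW /orP[/existsP[f /and3P[Hf ef fW]]|]]|_]; last first.
  - exact: addr_ge0.
  - move=> /existsP[b /andP[Hb /existsP[c /and4P[Hc /and3P[eb ebI cc] bW cW]]]].
    suff : 1 <= triples W e by lra.
    rewrite /triples (bigD1 b) ?Hb ?eb //= (bigD1 c) ?Hc //=.
    rewrite !subUset eW bW cW -addrA lerDl addr_ge0 //; first exact: sumr_ge0.
    by apply: sumr_ge0 => ? _; apply: sumr_ge0.
  - suff : 1 <= pairs W e by lra.
    by rewrite /pairs (bigD1 f) ?Hf //= subUset eW fW lerDl sumr_ge0.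
have F0 : set0 \notin F.
  rewrite inE; apply/negP => /andP[/Hk]; rewrite cards0 => k0.
  by move: k4; rewrite -k0.
have [X cX hX] := hitting_set F0.
pose U0 := W :\: X; pose H0 := induced U0.
have vertsE : verts W = #|W|%:R.
  rewrite /verts -sum1_card natr_sum [RHS]big_mkcond /=; apply: eq_bigr => v _.
  by rewrite sub1set; case: (v \in W).
have cU0 : n * p / 2 + kap * edges W <= #|U0|%:R.
  have : #|W|%:R <= #|U0|%:R + #|F|%:R :> R.
    rewrite -natrD ler_nat -(cardsID X W) addnC leq_add2l.
    exact: leq_trans (subset_leq_card (subsetIr _ _)) cX.
  by rewrite vertsE in hW; lra.
have cH0 : #|H0|%:R <= edges W.
  rewrite -sum1_card natr_sum big_mkcond /edges [leRHS]big_mkcond /=.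
  apply: ler_sum => e _; rewrite inE; case: (e \in H) => //=.
  case: ifP => // eU; by rewrite (subset_trans eU (subsetDl _ _)).
have H0W e : e \in H0 -> [/\ e \in H, e \subset W & [disjoint e & X]].
  by rewrite inE => /andP[He]; rewrite subsetD => /andP[].
have goodF e : e \in H0 -> e \notin F.
  by move=> /H0W[_ _ eX]; apply: contraL eX; exact: hX.
have np0 : 0 <= n * p by rewrite mulr_ge0.
have H0U0 : #|H0|%:R <= 4 * T ^+ (k - 1) * #|U0|%:R.
  have K0 : 0 < 4 * T ^+ (k - 1) by rewrite mulr_gt0.
  rewrite -[leLHS](mulVKf (lt0r_neq0 K0)) ler_pM2l // -/kap.
  have := ler_wpM2l (ltW kap0) cH0; lra.
pose D := 8 * k%:R * T ^+ (k - 1).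
have D0 : 0 < D by rewrite /D !mulr_gt0 // ltr0n (leq_trans _ k4).
pose U := [set u in U0 | (deg H0 [set u])%:R <= D].
have UU0 : U \subset U0 by apply/subsetP => u; rewrite inE => /andP[].
have indU e : e \in induced U -> e \in H0.
  by rewrite !inE => /andP[-> /= eU]; exact: subset_trans eU UU0.
have cHigh : #|U0 :\: U|%:R <= #|U0|%:R / 2 :> R.
  rewrite -(ler_pM2l D0).
  apply: le_trans (_ : (\sum_(u in U0) deg H0 [set u])%:R <= _).
    rewrite mulrC mulr_natl -sumr_const natr_sum big_mkcond [leRHS]big_mkcond /=.
    apply: ler_sum => u _; rewrite in_setD [u \in U]in_set.
    case: (u \in U0); rewrite ?andbF // andbT andTb -ltNge.
    by case: ifP => // /ltW.
  rewrite sum_deg; last by move=> e; rewrite inE => /andP[].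
  rewrite (eq_bigr (fun=> k)) => [|e /H0W[/Hk]//].
  rewrite sum_nat_const natrM /D.
  have := ler_wpM2r (ler0n R k) H0U0; lra.
exists U; split.
- have := cardsID U U0; rewrite (setIidPr UU0) => /(congr1 (fun j => j%:R : R)).
  rewrite natrD => cUU.
  have : 0 <= kap * edges W by rewrite mulr_ge0 ?sumr_ge0 // ltW.
  by rewrite -cUU in cU0 cHigh; lra.
- move=> u; have [uU|uU] := boolP (u \in U).
    move: (uU); rewrite inE => /andP[_]; apply: le_trans; rewrite ler_nat.
    apply: subset_leq_card; apply/subsetP => e; rewrite !inE.
    by case/andP=> /andP[-> /= eU] ->; rewrite (subset_trans eU).
  rewrite /deg (_ : [set e in _ | _] = set0) ?cards0 ?ltW //.
  apply/setP => e; rewrite !inE; apply/negbTE/negP => /andP[/andP[_ eU]].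
  by rewrite sub1set => /(subsetP eU); apply/negP.
- move=> e f /indU eH0 /indU fH0; have [He eW _] := H0W _ eH0.
  have [Hf fW _] := H0W _ fH0; have := goodF _ eH0; rewrite inE He /= /first eW /=.
  rewrite negb_or => /andP[/existsPn/(_ f)]; by rewrite Hf fW andbT.
- move=> a b c /indU aH0 /indU bH0 /indU cH0'; have [Ha aW _] := H0W _ aH0.
  have [Hb bW _] := H0W _ bH0; have [Hc cW _] := H0W _ cH0'.
  have := goodF _ aH0; rewrite inE Ha /= /first aW /= negb_or => /andP[_].
  by move=> /existsPn/(_ b); rewrite Hb /= => /existsPn/(_ c); rewrite Hc bW cW !andbT.
Qed.
End Sparsification.

(** * Choice of the number of steps *)

Section Density.
Variable R : realType.

(** With M = s, ln s = ell * ln t and degrees at most 8 k T^(k-1), taking at most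
    rate * (N / T) * (ln t)^(1/(k-1)) steps keeps the initial pressure charge of
    weighted_greedy within its bound. *)
Definition rate (k : nat) (ell : R) : R :=
  ell / (128 * k%:R ^+ 3 * expR (growth R k + 1)).

Lemma growth_ge0 k : 0 <= growth R k.
Proof. by rewrite /growth mulr_ge0 ?exprn_ge0 // addr_ge0 ?mulr_ge0. Qed.

Lemma rate_den_gt0 k : (0 < k)%N ->
  0 < 128 * k%:R ^+ 3 * expR (growth R k + 1).
Proof.
move=> k0; apply: mulr_gt0 (expR_gt0 _); apply: mulr_gt0 => //.
by apply: exprn_gt0; rewrite ltr0n.
Qed.

Lemma rate_gt0 k ell : (0 < k)%N -> 0 < ell -> 0 < rate k ell.
Proof.
by move=> k0 l0; apply: divr_gt0 => //; exact: rate_den_gt0.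
Qed.

Lemma rate_le k ell : (0 < k)%N -> 0 < ell -> ell <= 1 -> rate k ell <= 1 / 8.
Proof.
move=> k0 l0 l1; rewrite /rate ler_pdivrMr ?rate_den_gt0 //.
have k1 : 1 <= k%:R ^+ 3 :> R by rewrite exprn_ege1 // ler1n.
have e1 : 1 <= expR (growth R k + 1).
  apply: le_trans (expR_ge1Dx _); have := growth_ge0 k; lra.
have : 1 <= k%:R ^+ 3 * expR (growth R k + 1) by exact: mulr_ege1.
by rewrite -mulrA; lra.
Qed.

(** With x = m s^2 / N, dividing the pressure condition of weighted_greedy by
    N * (N / m)^(k-2) leaves 128 k^3 E x^(k-1) <= ln s, with E the exponential of
    growth k + 1.  As x <= rate * L, this follows from L^(k-1) = ln s / ell. *)
Lemma greedy_density (V : finType) (H : {set {set V}}) (U : {set V}) (k : nat)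
    (s L ell : R) :
  uniform k H -> (2 <= k)%N ->
  (forall e, e \in H -> e \subset U) ->
  (forall e x y, e \in H -> x \in e -> y \in e -> x != y ->
     (#|shared H e x y| <= 1)%N) ->
  (forall u, (deg H [set u])%:R <= 8 * k%:R * (s ^+ 2) ^+ (k - 1)) ->
  1 < s -> 1 <= L -> L <= s -> 0 < ell -> ell <= 1 -> 1 <= ln s ->
  ln s = ell * L ^+ (k - 1) ->
  (1 + k%:R * (8 * k%:R * (s ^+ 2) ^+ (k - 1))) * s <= #|U|%:R / 4 ->
  1 <= rate k ell * (#|U|%:R * L / s ^+ 2) ->
  exists I : {set V}, [/\ I \subset U, independent H I &
    rate k ell * (#|U|%:R * L / s ^+ 2) / 2 <= #|I|%:R].
Proof.
move=> Hk k2 HU sh1 hd s1 L1 Ls l0 l1 lns1 lnsE hbig y1.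
have s0 : 0 < s by lra.
have a0 := rate_gt0 (ltnW k2) l0; have a8 := rate_le (ltnW k2) l0 l1.
set a := rate k ell in y1 a0 a8 *; set N : R := #|U|%:R in hbig y1 *.
have N0 : 0 < N.
  rewrite lt_def ler0n andbT; apply: contraTneq y1 => ->.
  by rewrite !mul0r mulr0 ler10.
set y := a * (N * L / s ^+ 2) in y1 *; pose m := Num.truncn y.
have s20 : 0 < s ^+ 2 by rewrite exprn_gt0.
have y0 : 0 <= y by lra.
have /andP[my ym] := truncn_itv y0; rewrite -/m in my ym.
have m1 : (1 <= m)%N by rewrite truncn_ge_nat.
have m1R : 1 <= m%:R :> R by rewrite ler1n.
have m0R : 0 < m%:R :> R by lra.
have half : y / 2 <= m%:R by rewrite -natr1 in ym; lra.
have sm : s * m%:R <= a * N.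
  apply: le_trans (ler_wpM2l (ltW s0) my) _.
  have -> : s * y = a * N * (L / s) by rewrite /y; field; rewrite gt_eqF.
  apply: ler_piMr; first by apply: mulr_ge0; exact: ltW.
  by rewrite ler_pdivrMr // mul1r.
have aN : a * N <= 1 / 8 * N by rewrite ler_pM2r.
have [|||I [IU Iind cI]] := weighted_greedy Hk k2 HU sh1 hd s1 m1 hbig.
- by rewrite -/N; lra.
- have : N / 4 <= ln s * (N / 4) by rewrite ler_peMl //; lra.
  by rewrite -/N -mulrA; lra.
- rewrite -/N; set E := expR _; have E0 : 0 < E := expR_gt0 _.
  pose x := m%:R * s ^+ 2 / N; have x0 : 0 < x by rewrite !(mulr_gt0, invr_gt0).
  have xaL : x <= a * L.
    rewrite /x ler_pdivrMr //; apply: le_trans (ler_wpM2r (ltW s20) my) _.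
    by rewrite /y le_eqVlt; apply/orP; left; apply/eqP; field; rewrite gt_eqF.
  have xk : x ^+ (k - 1) <= a * L ^+ (k - 1).
    apply: le_trans (_ : (a * L) ^+ (k - 1) <= _).
      apply: lerXn2r; rewrite // nnegrE; first exact: ltW.
      by apply: mulr_ge0; [exact: ltW|exact: le_trans L1].
    rewrite exprMn ler_wpM2r ?exprn_ge0 //; first by lra.
    rewrite (_ : (k - 1 = (k - 2).+1)%N); last by rewrite -subSn // subSS subn1.
    by rewrite exprS ler_piMr ?exprn_ile1 //; lra.
  have Nm0 : 0 < (N / m%:R) ^+ (k - 2) by rewrite exprn_gt0 // divr_gt0.
  have split3 z : z ^+ (k - 1) = z ^+ (k - 2) * z :> R.
    by rewrite -exprSr; congr (_ ^+ _); rewrite -subSn // subSS subn1.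
  have -> : 16 * (k ^ 2)%:R * E * (8 * k%:R * (s ^+ 2) ^+ (k - 1)) * m%:R =
      N * (N / m%:R) ^+ (k - 2) * (128 * k%:R ^+ 3 * E * x ^+ (k - 1)).
    rewrite natrX /x !split3 !exprMn !exprVn; field.
    by rewrite !gt_eqF ?exprn_gt0.
  rewrite ler_pM2l ?mulr_gt0 // lnsE.
  have kE : 0 < 128 * k%:R ^+ 3 * E := rate_den_gt0 (ltnW k2).
  apply: le_trans (ler_wpM2l (ltW kE) xk) _.
  rewrite mulrA /a /rate -/E mulrCA divff ?mulr1 // gt_eqF //.
by exists I; rewrite cI.
Qed.

End Density.

(** * The theorem *)

Lemma deg_le_max_deg (V : finType) (H : {set {set V}}) (S : {set V}) :
  (deg H S <= max_deg #|S| H)%N.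
Proof. by rewrite /max_deg (leq_bigmax_cond (F := deg H)). Qed.

Lemma card_le_alpha (V : finType) (H : {set {set V}}) (I : {set V}) :
  independent H I -> (#|I| <= alpha H)%N.
Proof. by move=> ?; rewrite /alpha (leq_bigmax_cond (F := fun I : {set V} => #|I|)). Qed.

Lemma independent_induced (V : finType) (H : {set {set V}}) (U I : {set V}) :
  I \subset U -> independent (induced H U) I -> independent H I.
Proof.
move=> IU /forallP ind; apply/forallP => e; apply/implyP => He.
apply/negP => eI; have := ind e.
by rewrite inE He (subset_trans eI IU) eI.
Qed.

Section Estimates.
Variable R : realType.
Implicit Types (k : nat) (s t N a L eps : R).

Lemma sampling_condition k s : (0 < k)%N -> 16 <= s ->
  16 * 8 ^+ k * (s ^+ 2) ^+ (3 * k) <= s ^+ (8 * k).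
Proof.
move=> k0 s16.
rewrite -exprM (_ : 8 * k = 2 * k + 2 * (3 * k))%N; last by rewrite mulnA -mulnDl.
rewrite exprD; apply: ler_wpM2r; first by apply: exprn_ge0; lra.
apply: le_trans (_ : 16 ^+ k * 8 ^+ k <= _).
  apply: ler_wpM2r; first exact: exprn_ge0.
  by rewrite -[leLHS]expr1 ler_weXn2l // ler1n.
rewrite mul2n -addnn exprD.
have hs c : 0 <= c -> c <= s -> c ^+ k <= s ^+ k.
  by move=> c0 cs; apply: lerXn2r => //; rewrite nnegrE //; lra.
by apply: ler_pM; [exact: exprn_ge0|exact: exprn_ge0|apply: hs|apply: hs];
  rewrite //; lra.
Qed.

Lemma size_conditions k s N a L : (4 <= k)%N -> 144 * k%:R ^+ 2 <= s ->
    0 < a -> 4 / a <= s -> 1 <= L -> s ^+ 2 * s ^+ (8 * k) / 4 <= N ->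
  (1 + k%:R * (8 * k%:R * (s ^+ 2) ^+ (k - 1))) * s <= N / 4 /\
  1 <= a * (N * L / s ^+ 2).
Proof.
move=> k4 sk a0 sa L1 hN; have kR : 4 <= k%:R :> R by rewrite ler_nat.
have kk0 : 16 <= k%:R ^+ 2 :> R by rewrite expr2; nra.
have s1 : 1 <= s by lra.
have s0 : 0 < s by lra.
have kk : k = (k - 1).+1 by rewrite -subSn ?subSS ?subn0 // (leq_trans _ k4).
split.
  have sp : 1 <= (s ^+ 2) ^+ (k - 1) by rewrite exprn_ege1 // exprn_ege1.
  have h1 : 1 + k%:R * (8 * k%:R * (s ^+ 2) ^+ (k - 1)) <=
      9 * k%:R ^+ 2 * (s ^+ 2) ^+ (k - 1).
    by move: sp kk0; rewrite expr2; set z := _ ^+ (k - 1); nra.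
  apply: le_trans (ler_wpM2r (ltW s0) h1) _.
  have h2 : s ^+ (2 * k) <= s ^+ 2 * s ^+ (8 * k).
    rewrite -exprD; apply: ler_weXn2l => //.
    by apply: leq_trans (leq_addl _ _); rewrite leq_mul2r orbT.
  have s2k : s * ((s ^+ 2) ^+ (k - 1) * s) = s ^+ (2 * k).
    by rewrite -exprM -exprSr -exprS; congr (_ ^+ _); rewrite {2}kk mulnS.
  have h3 : 144 * k%:R ^+ 2 * ((s ^+ 2) ^+ (k - 1) * s) <= s ^+ (2 * k).
    by rewrite -s2k; apply: ler_wpM2r => //; apply: mulr_ge0; lra.
  have -> : 9 * k%:R ^+ 2 * (s ^+ 2) ^+ (k - 1) * s =
      144 * k%:R ^+ 2 * ((s ^+ 2) ^+ (k - 1) * s) / 16 by field.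
  by have := le_trans h3 h2; lra.
have s20 : 0 < s ^+ 2 by rewrite exprn_gt0.
have N_s : s / 4 <= N / s ^+ 2.
  rewrite ler_pdivlMr //; apply: le_trans hN.
  have -> : s / 4 * s ^+ 2 = s ^+ 2 * s / 4 by field.
  rewrite ler_pM2r ?invr_gt0 // ler_pM2l //.
  by rewrite -[leLHS]expr1 ler_weXn2l // muln_gt0 (leq_trans _ k4).
have h : 1 <= a * (s / 4) by move: sa; rewrite ler_pdivrMr // mulrC; lra.
apply: le_trans h _; rewrite ler_pM2l //; apply: le_trans N_s _.
rewrite [N * L]mulrC -mulrA; apply: ler_peMl => //.
apply: divr_ge0; last exact: ltW.
by apply: le_trans hN; rewrite divr_ge0 // mulr_ge0 // exprn_ge0 // ltW.
Qed.

(** With l = ln n the hypothesis t >= (ln n)^(12k/eps) says that ln n is at most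
    t^(eps/12k), hence at most s = t^(eps/8k).  It makes s large and bounds ln t by
    s. *)
Lemma ln_le_scale k eps t l : (0 < k)%N -> 0 < eps -> 0 <= l -> 1 <= t ->
  l `^ (12 * k%:R / eps) <= t -> l <= t `^ (eps / (8 * k%:R)).
Proof.
move=> k0 e0 l0 t1 lt; have k0R : 0 < k%:R :> R by rewrite ltr0n.
have -> : l = (l `^ (12 * k%:R / eps)) `^ (eps / (12 * k%:R)).
  rewrite -powRrM (_ : _ * _ = 1) ?powRr1 //.
  by field; apply/andP; split; lra.
apply: le_trans (_ : t `^ (eps / (12 * k%:R)) <= _).
  apply: ge0_ler_powR => //; rewrite ?nnegrE ?powR_ge0 //; last by lra.
  by rewrite divr_ge0 //; lra.
by apply: ler_powR => //; rewrite ler_pM2l // lef_pV2 ?posrE; lra.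
Qed.

(** For m = n this is n >= t^(1 + eps): after sampling, the number of vertices
    still exceeds every power of the new degree parameter that occurs. *)
Lemma mul_powR_le eps t m : 0 < eps -> 0 < t -> 0 <= m ->
  t <= m `^ (1 / (1 + eps)) -> t * t `^ eps <= m.
Proof.
move=> e0 t0 m0 tm.
have -> : t * t `^ eps = t `^ (1 + eps).
  have tn0 : t != 0 by rewrite gt_eqF.
  by rewrite powRD ?tn0 ?implybT // powRr1 // ltW.
have -> : m = (m `^ (1 / (1 + eps))) `^ (1 + eps).
  rewrite -powRrM (_ : _ * _ = 1) ?powRr1 //.
  by field; lra.
by apply: ge0_ler_powR; rewrite ?nnegrE ?powR_ge0 //; lra.
Qed.

End Estimates.

Lemma codegree_bounds (R : realType) (V : finType) (H : {set {set V}}) (k : nat)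
    (t eps : R) : (2 <= k)%N -> 1 <= t -> 0 < eps -> 1 <= ln t ->
    (max_deg 1 H)%:R <= t ^+ (k - 1) ->
    (forall i : nat, (2 <= i <= k - 2)%N ->
       (max_deg i H)%:R <= t `^ (k%:R - i%:R - eps)) ->
    (max_deg (k - 1) H)%:R <= t / ln t ^+ (k + 1) ->
  (forall S : {set V}, (0 < #|S| < k)%N -> (deg H S)%:R <= t ^+ (k - #|S|)) /\
  (forall S : {set V}, (2 <= #|S| <= k - 2)%N ->
     (deg H S)%:R * t `^ eps <= t ^+ (k - #|S|)).
Proof.
move=> k2 t1 e0 lnt1 hd1 hdi hdk; have t0 : 0 < t by lra.
have tn0 : t != 0 by rewrite gt_eqF.
have tau1 : 1 <= t `^ eps by rewrite -(powRr0 t); apply: ler_powR => //; exact: ltW.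
have hmax (S : {set V}) : (deg H S)%:R <= (max_deg #|S| H)%:R :> R.
  by rewrite ler_nat deg_le_max_deg.
have hdeg2 (S : {set V}) : (2 <= #|S| <= k - 2)%N ->
    (deg H S)%:R * t `^ eps <= t ^+ (k - #|S|).
  move=> hS; rewrite -ler_pdivlMr ?powR_gt0 //.
  apply: le_trans (hmax S) _; apply: le_trans (hdi _ hS) _.
  rewrite powRB ?tn0 ?implybT // -natrB; last first.
    by case/andP: hS => _ h; exact: leq_trans h (leq_subr _ _).
  by rewrite powR_mulrn // ltW.
split=> // S /andP[S0 Sk].
have [S1|S1] := eqVneq #|S| 1%N.
  by apply: le_trans (hmax S) _; rewrite S1.
have [Sk1|Sk1] := eqVneq #|S| (k - 1)%N.
  apply: le_trans (hmax S) _; rewrite Sk1; apply: le_trans hdk _.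
  rewrite subKn ?(ltnW k2) // expr1 ler_pdivrMr; last by rewrite exprn_gt0 //; lra.
  by apply: ler_peMr; [exact: ltW|exact: exprn_ege1].
apply: le_trans (hdeg2 S _); first by rewrite ler_peMr.
by move: S0 Sk S1 Sk1; clear; lia.
Qed.

Theorem theorem1p7 (R : realType) (k : nat) (eps : R)
    (hk : (4 <= k)%N) (heps0 : 0 < eps) (heps1 : eps <= 1) :
  exists (c : R) (n0 : nat), 0 < c /\
    forall (n : nat) (t : R),
      (n0 <= n)%N ->
      ln (n%:R : R) `^ (12 * k%:R / eps) <= t ->
      t <= n%:R `^ (1 / (1 + eps)) ->
    forall (V : finType) (H : {set {set V}}),
      #|V| = n ->
      uniform k H ->
      (max_deg 1 H)%:R <= t ^+ (k - 1) ->
      (forall i : nat, (2 <= i <= k - 2)%N ->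
         (max_deg i H)%:R <= t `^ (k%:R - i%:R - eps)) ->
      (max_deg (k - 1) H)%:R <= t / ln t ^+ (k + 1) ->
      ~ has_clean_four_cycle H ->
      c * (n%:R / t) * ln t `^ (1 / (k%:R - 1)) <= (alpha H)%:R.
Proof.
have kR : 4 <= k%:R :> R by rewrite ler_nat.
have k2N : (2 <= k)%N by apply: leq_trans hk.
have k1N : (1 <= k)%N by apply: leq_trans hk.
have k1E : k%:R - 1 = (k - 1)%:R :> R by rewrite natrB.
have kinv0 : 0 <= 1 / (k%:R - 1) :> R by rewrite divr_ge0 //; lra.
have kinv1 : 1 / (k%:R - 1) <= 1 :> R by rewrite ler_pdivrMr; lra.
pose ell : R := eps / (8 * k%:R).
have l0 : 0 < ell by rewrite divr_gt0 //; lra.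
have l1 : ell <= 1 by rewrite ler_pdivrMr; lra.
pose a := rate k ell; have a0 : 0 < a := rate_gt0 k1N l0.
pose B : R := 144 * k%:R ^+ 2 + 4 / a + expR 1.
have ia0 : 0 < 4 / a by rewrite divr_gt0.
have kk0 : 16 <= k%:R ^+ 2 :> R by rewrite expr2; nra.
have e2 : 2 <= expR 1 :> R by have := expR_ge1Dx (1 : R); lra.
exists (a / 8), (Num.truncn (expR B)).+1; split; first by rewrite divr_gt0.
move=> n t nB tlo thi V H cV Hk hd1 hdi hdk _.
have nB' : expR B < n%:R.
  have /andP[_ h] := truncn_itv (expR_ge0 B).
  by apply: lt_le_trans h _; rewrite ler_nat.
have n0 : 0 < n%:R :> R by apply: lt_trans nB'; exact: expR_gt0.
have lnB : B <= ln (n%:R : R).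
  by rewrite -[B]expRK ler_ln ?posrE ?expR_gt0 // ltW.
set l := ln (n%:R : R) in tlo lnB.
have [lk la le] : [/\ 144 * k%:R ^+ 2 <= l, 4 / a <= l & expR 1 <= l].
  by move: lnB; rewrite /B; split; lra.
have l1' : 1 <= l by lra.
have n1 : 1 <= n%:R :> R.
  by rewrite ltW // (le_lt_trans _ nB') // -expR0 ler_expR /B; lra.
have q1 : 1 <= 12 * k%:R / eps by rewrite ler_pdivlMr //; lra.
have lt : l <= t by apply: le_trans tlo; rewrite le1r_powR.
have t1 : 1 <= t by lra.
have t0 : 0 < t by lra.
have tn : t <= n%:R.
  apply: le_trans thi _; apply: ler1_powR => //.
  by rewrite ler_pdivrMr; lra.
have lnt_l : ln t <= l by rewrite ler_ln.
have lnt1 : 1 <= ln t.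
  by rewrite -[1](expRK (1 : R)) ler_ln ?posrE ?expR_gt0 //; lra.
pose s := t `^ ell.
have ls : l <= s by apply: ln_le_scale => //; lra.
have s1 : 1 < s by lra.
have s0 : 0 < s by lra.
have lns : ln s = ell * ln t by rewrite ln_powR.
have lns1 : 1 <= ln s.
  by rewrite -[1](expRK (1 : R)) ler_ln ?posrE ?expR_gt0 //; lra.
have tauE : t `^ eps = s ^+ (8 * k).
  rewrite -powR_mulrn ?ltW // -powRrM; congr (_ `^ _).
  by rewrite /ell natrM; field; lra.
have tau_t : t `^ eps <= t by rewrite ler1_powR.
have ttau : t * s ^+ (8 * k) <= n%:R by rewrite -tauE mul_powR_le // ltW.
have [hdeg hdeg2] := codegree_bounds k2N t1 heps0 lnt1 hd1 hdi hdk.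
rewrite tauE in tau_t hdeg2.
have T1 : 1 <= s ^+ 2 by rewrite exprn_ege1 // ltW.
have Tt : s ^+ 2 <= t.
  apply: le_trans tau_t; apply: ler_weXn2l; first exact: ltW.
  by rewrite (leq_trans _ (leq_pmulr 8 k1N)).
have tau0 : 0 < s ^+ (8 * k) by rewrite exprn_gt0.
have s16 : 16 <= s by lra.
(* in the sample the number n / t is replaced by N / T, T = s ^+ 2 *)
have [U [cU dU pU tU]] := clean_sample Hk hk T1 Tt tau0 hdeg hdeg2
  (sampling_condition k1N s16).
rewrite cV in cU.
pose L := ln t `^ (1 / (k%:R - 1)).
have LE : L ^+ (k - 1) = ln t.
  rewrite -powR_mulrn ?powR_ge0 // -powRrM -k1E (_ : _ * _ = 1).
    by rewrite powRr1 //; lra.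
  by field; lra.
have L1 : 1 <= L.
  apply: le_trans (_ : 1 `^ (1 / (k%:R - 1)) <= _); first by rewrite powR1.
  by apply: ge0_ler_powR => //; rewrite nnegrE; lra.
have Ls : L <= s.
  apply: le_trans (_ : ln t <= _); last by lra.
  exact: ler1_powR.
have NT : s ^+ 2 * s ^+ (8 * k) / 4 <= #|U|%:R :> R.
  apply: le_trans cU; rewrite ler_pM2r ?invr_gt0 //.
  have -> : n%:R * (s ^+ 2 / t) = s ^+ 2 * (n%:R / t) by rewrite mulrCA.
  rewrite ler_pM2l ?exprn_gt0 //.
  by rewrite ler_pdivlMr // mulrC.
have [big1 y1] := size_conditions hk (le_trans lk ls) a0 (le_trans la ls) L1 NT.
have indk : uniform k (induced H U) by move=> e; rewrite inE => /andP[/Hk].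
have indU e : e \in induced H U -> e \subset U by rewrite inE => /andP[].
have lnsE : ln s = ell * L ^+ (k - 1) by rewrite LE.
have [I [IU Iind cI]] := greedy_density indk k2N indU
  (fun e x y He xe ye xy => shared_le1 indk hk pU tU He xe ye xy) dU s1 L1 Ls
  l0 l1 lns1 lnsE big1 y1.
apply: le_trans (_ : #|I|%:R <= _); last first.
  by rewrite ler_nat card_le_alpha // (independent_induced IU).
apply: le_trans cI; rewrite -/L -/a.
have -> : a / 8 * (n%:R / t) * L =
    a * (n%:R * (s ^+ 2 / t) / 4 * L / s ^+ 2) / 2.
  by field; rewrite !gt_eqF.
rewrite ler_pM2r ?invr_gt0 // ler_pM2l // ler_pM2r ?invr_gt0 ?exprn_gt0 //.
by apply: ler_wpM2r => //; lra.
Qed.
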